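(* Let $n$ be a nonnegative integer. Then, as an identity between meromorphic functions of the complex variable $x$ (in particular, for every complex $x$ such that $2x$ is not an integer $\le 2n$), $$\sum_{k=0}^n\frac{(-1)^k}{2^{2k}}\binom{x}{n-k}C_kH_{x+k-n} = \frac{2n+1}{2^{2n}}\,\frac{\binom{2x+1}{2n+2}}{\binom{x}{n+1}}\bigl(2H_x-H_{x-n-1}+2H_{2x-2n-1}-2H_{2x+1}\bigr)C_n-2\binom{x}{n+1}H_{x-n-1}.$$
   Context: $C_n=\frac{1}{n+1}\binom{2n}{n}$, $n\ge 0$, are the Catalan numbers. For complex $x$ and nonnegative integer $k$, $\binom{x}{k}=\frac{x(x-1)\cdots(x-k+1)}{k!}$. For complex $z$ not a negative integer, $H_z=\psi(z+1)+\gamma$, where $\psi=\Gamma'/\Gamma$ is the digamma function and $\gamma$ is the Euler--Mascheroni constant. *)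

(* Defs.v *)
From Stdlib Require Export Reals ZArith.
From Coquelicot Require Export Coquelicot.

Local Open Scope C_scope.

Definition Cexp (z : C) : C :=
  ((exp (Re z) * cos (Im z))%R, (exp (Re z) * sin (Im z))%R).

(* The limit of [u] whenever [u] converges; unspecified otherwise. *)
Definition CLim_seq (u : nat -> C) : C :=
  (real (Lim_seq (fun n => Re (u n))), real (Lim_seq (fun n => Im (u n)))).

(* f 0 * f 1 * ... * f (n - 1) *)
Fixpoint Cprod (f : nat -> C) (n : nat) : C :=
  match n with
  | O => 1
  | S m => Cprod f m * f m
  end.

(* Gauss's limit n! n^z / (z (z + 1) ... (z + n)), valid on the whole domain
   C \ {0, -1, -2, ...}; the value at the poles is meaningless. *)
Definition CGamma (z : C) : C :=
  CLim_seq (fun n =>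
    INR (fact n) * Cexp (z * ln (INR n)) / Cprod (fun j => z + INR j) (S n)).

(* [C_derive f z] is the complex derivative wherever f is complex
   differentiable at z ([is_C_derive_unique]). *)
Definition digamma (z : C) : C := C_derive CGamma z / CGamma z.

(* lim (1 + 1/2 + ... + 1/(n+1) - ln (n+1)) *)
Definition euler_mascheroni : R :=
  real (Lim_seq (fun n => sum_n (fun k => / INR (S k))%R n - ln (INR (S n)))%R).

Definition Harm (z : C) : C := digamma (z + 1) + euler_mascheroni.

Definition Cbinom (x : C) (k : nat) : C :=
  Cprod (fun j => x - INR j) k / INR (fact k).

(* [Binomial.C] is the binomial coefficient, not the complex numbers. *)
Definition catalan (n : nat) : R := (/ (INR n + 1) * Binomial.C (2 * n) n)%R.

(* Functions C -> C are total, so values at poles carry no information: only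
   punctured neighbourhoods ([locally']) matter here. *)
Definition meromorphic (f : C -> C) : Prop :=
  forall z0 : C, exists (m : nat) (g : C -> C),
    locally z0 (fun z => ex_derive g z) /\
    locally' z0 (fun z => f z = g z / (z - z0) ^ m).

(* Equality in the field of meromorphic functions on C: the two functions agree
   off a closed discrete set. *)
Definition meromorphic_eq (f g : C -> C) : Prop :=
  meromorphic f /\ meromorphic g /\
  forall z0 : C, locally' z0 (fun z => f z = g z).

(* Main.v *)
Require Import Defs.
From Stdlib Require Import Lra Lia.

(* Vandermonde's formula at x + 1/2 gives
     S(x) := sum_k (-1/4)^k C_k binom(x, n-k) = 2 binom(x + 1/2, n+1) - 2 binom(x, n+1),
   because 2 binom(1/2, k+1) = (-1/4)^k C_k.  Duplication turns the quotient of
   binomials on the right-hand side into 2 binom(x + 1/2, n+1), and the functional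
   equation of H reduces the theorem to S(x) H_x - S'(x), computed from both
   expressions of S.

   The analytic input is that digamma is holomorphic off its poles and satisfies
   psi(z+1) = psi(z) + 1/z.  Instead of Cauchy's theorem: if F_n -> f pointwise,
   F_n'(z) -> g and F_n'' is bounded near z uniformly in n, then Taylor's estimate
   passes to the limit and f'(z) = g.  This is applied to Gauss's approximants of
   Gamma and to their logarithmic derivatives. *)

Local Open Scope R_scope.

(** * Complex differentiation and limits of sequences *)

(** The two expressions of S meet the harmonic numbers because T_k(y) = sum_{j<k} 1/(y - j) plays
    two roles: it is the logarithmic derivative of binom(y, k), and it equals H_y - H_{y-k}. So
    binom(x, n-k) H_{x-(n-k)} is H_x binom(x, n-k) minus the derivative of binom(x, n-k), and the
    left-hand side is S(x) H_x - S'(x). On the right, write T = T_{n+1}(x), T' = T_{n+1}(x + 1/2), R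
    = T_{2n+2}(2x + 1). The bracket is 2 H_x - (H_x - T) - 2 R, and splitting R by parity gives 2 R
    = T + T', so the bracket is H_x - T'. The uniform bounds all have one source: for v in a bounded
    set, passing from n to n+1 changes the logarithmic derivatives by O(1/n^2), and changes Gauss's
    approximant by O(1/n^2) relative to its size. Comparison with 1/n - 1/(n+1) then gives
    convergence, boundedness and a nonzero limit with explicit constants. The condition on 2x says
    exactly that 2x - 2n is none of 0, -1, -2, ...; even offsets protect the factors x - j, odd ones
    the factors x + 1/2 - j. *)

Lemma is_derive_C_iff (f : C -> C) (z l : C) :
  is_derive f z l <->
  forall eps : posreal, exists d : posreal, forall w,
    Cmod (w - z) < d -> Cmod (f w - f z - (w - z) * l) <= eps * Cmod (w - z).
Proof.
split.
- intros [_ H] eps.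
  destruct (H z (fun P HP => HP) eps) as [d Hd].
  exists d; intros w Hw; apply (Hd w Hw).
- intros H; split.
  + apply is_linear_scal_l.
  + intros x Hx eps.
    apply (is_filter_lim_locally_unique (V := AbsRing_NormedModule C_AbsRing)) in Hx.
    subst x.
    destruct (H eps) as [d Hd].
    exists d; intros w Hw; apply (Hd w Hw).
Qed.

(* Coquelicot carries two normed module structures on C over itself; its product
   and composition rules are stated for the second one. *)
Lemma is_derive_C_AbsRing (f : C -> C) (z l : C) :
  is_derive f z l <-> is_derive (V := AbsRing_NormedModule C_AbsRing) f z l.
Proof.
split; intros [[H1 H2 H3] H4]; (split; [split|]); assumption.
Qed.

Lemma is_derive_Cmult (f g : C -> C) (z df dg : C) :
  is_derive f z df -> is_derive g z dg ->
  is_derive (fun w => f w * g w)%C z (df * g z + f z * dg)%C.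
Proof.
rewrite !is_derive_C_AbsRing; intros Hf Hg.
exact (is_derive_mult (K := C_AbsRing) f g z df dg Hf Hg Cmult_comm).
Qed.

Lemma is_derive_Cid (z : C) : is_derive (fun w : C => w) z (RtoC 1).
Proof. apply is_derive_C_AbsRing. exact (is_derive_id (K := C_AbsRing) z). Qed.

Lemma is_derive_Cconst (c z : C) : is_derive (fun _ : C => c) z (RtoC 0).
Proof. apply (is_derive_const (K := C_AbsRing) (V := C_NormedModule)). Qed.

Lemma is_derive_Cplus (f g : C -> C) (z df dg : C) :
  is_derive f z df -> is_derive g z dg ->
  is_derive (fun w => f w + g w)%C z (df + dg)%C.
Proof. apply (is_derive_plus (K := C_AbsRing) (V := C_NormedModule)). Qed.

Lemma is_derive_Cminus (f g : C -> C) (z df dg : C) :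
  is_derive f z df -> is_derive g z dg ->
  is_derive (fun w => f w - g w)%C z (df - dg)%C.
Proof. apply (is_derive_minus (K := C_AbsRing) (V := C_NormedModule)). Qed.

Lemma is_derive_Ccomp (f g : C -> C) (z df dg : C) :
  is_derive f (g z) df -> is_derive g z dg ->
  is_derive (fun w => f (g w)) z (dg * df)%C.
Proof.
intros Hf Hg; apply is_derive_C_AbsRing in Hg.
exact (is_derive_comp (K := C_AbsRing) (V := C_NormedModule) f g z df dg Hf Hg).
Qed.

Lemma is_derive_eq (f : C -> C) (z l l' : C) :
  is_derive f z l -> l = l' -> is_derive f z l'.
Proof. now intros H <-. Qed.

Lemma Cmod_triangle_lower (a b : C) : Cmod a - Cmod b <= Cmod (a - b).
Proof.
generalize (Cmod_triangle (a - b) b).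
replace (a - b + b)%C with a by ring. lra.
Qed.

Lemma Cmod_minus_sym (a b : C) : Cmod (a - b) = Cmod (b - a).
Proof. rewrite <- Cmod_opp. f_equal. ring. Qed.

Lemma is_derive_Cinv (z : C) :
  z <> 0 -> is_derive (fun w : C => / w)%C z (- / (z * z))%C.
Proof.
intros Hz; apply is_derive_C_iff; intros eps.
assert (Hm : 0 < Cmod z) by now apply Cmod_gt_0.
(* The error term is (w - z)^2 / (w z^2), and |w| >= |z|/2 bounds 1/|w z^2| by this [K]. *)
pose (K := 2 / (Cmod z * Cmod z * Cmod z)).
assert (HK : 0 < K) by (unfold K; apply Rdiv_lt_0_compat; [lra | repeat apply Rmult_lt_0_compat; lra]).
assert (Hd : 0 < Rmin (Cmod z / 2) (eps / K)).
{ apply Rmin_pos; [lra | apply Rdiv_lt_0_compat; [apply cond_pos | lra]]. }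
exists (mkposreal _ Hd); simpl; intros w Hw.
assert (H1 := Rlt_le_trans _ _ _ Hw (Rmin_l _ _)).
assert (H2 := Rlt_le_trans _ _ _ Hw (Rmin_r _ _)).
assert (Hw2 : Cmod z / 2 <= Cmod w).
{ generalize (Cmod_triangle_lower z w). rewrite Cmod_minus_sym. lra. }
assert (Hw0 : w <> 0) by (apply Cmod_gt_0; lra).
replace (/ w - / z - (w - z) * - / (z * z))%C
  with ((w - z) * (w - z) / (w * (z * z)))%C by (field; auto).
rewrite Cmod_div by (repeat apply Cmult_neq_0; auto).
rewrite !Cmod_mult.
assert (H3 : 0 <= Cmod (w - z)) by apply Cmod_ge_0.
apply Rle_trans with (Cmod (w - z) * Cmod (w - z) * K).
- unfold Rdiv at 1; apply Rmult_le_compat_l; [nra|].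
  unfold K.
  replace (2 / (Cmod z * Cmod z * Cmod z)) with (/ (Cmod z / 2 * (Cmod z * Cmod z))) by (field; lra).
  apply Rinv_le_contravar; [repeat apply Rmult_lt_0_compat; lra|].
  apply Rmult_le_compat_r; [nra | lra].
- rewrite Rmult_assoc, (Rmult_comm (pos eps)).
  apply Rmult_le_compat_l; [lra|].
  apply Rle_trans with (eps / K * K); [apply Rmult_le_compat_r; lra|].
  apply Req_le; field; lra.
Qed.

(** Restricts a holomorphic function to a segment and projects it to a real line, so that the real
    mean value inequality applies; [c] will be the conjugate of an increment. *)
Lemma is_derive_Re_line (f : C -> C) (a b c l : C) (t : R) :
  is_derive f (a + t * b)%C l ->
  is_derive (fun s : R => Re (c * f (a + s * b))%C) t (Re (c * (b * l))%C).
Proof.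
intros H; apply is_derive_Reals; intros eps Heps.
rewrite is_derive_C_iff in H.
pose (K := Cmod c * Cmod b + 1).
assert (HK : 0 < K) by (unfold K; generalize (Cmod_ge_0 c) (Cmod_ge_0 b); nra).
assert (He : 0 < eps / K) by now apply Rdiv_lt_0_compat.
destruct (H (mkposreal _ He)) as [d Hd]; simpl in Hd.
assert (Hd' : 0 < d / (Cmod b + 1)).
{ apply Rdiv_lt_0_compat; [apply cond_pos | generalize (Cmod_ge_0 b); lra]. }
exists (mkposreal _ Hd'); intros h Hh Hhd; simpl pos in Hhd.
specialize (Hd (a + (t + h)%R * b)%C).
cbv beta; rewrite RtoC_plus in *.
replace (a + (t + h) * b - (a + t * b))%C with (h * b)%C in Hd by ring.
rewrite Cmod_mult, Cmod_R in Hd.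
set (D := (f (a + (t + h) * b) - f (a + t * b) - h * b * l)%C) in *.
assert (HE : (Re (c * f (a + (t + h) * b))%C - Re (c * f (a + t * b))%C) / h - Re (c * (b * l))%C
             = Re (c * D)%C / h).
{ unfold D, Cminus; simpl; field; exact Hh. }
rewrite HE; clear HE.
assert (Hh0 : 0 < Rabs h) by now apply Rabs_pos_lt.
assert (Hlt : Rabs h * Cmod b < d).
{ apply Rle_lt_trans with (Rabs h * (Cmod b + 1)); [nra|].
  apply Rlt_le_trans with (d / (Cmod b + 1) * (Cmod b + 1)).
  - apply Rmult_lt_compat_r; [generalize (Cmod_ge_0 b); lra | exact Hhd].
  - apply Req_le; field; generalize (Cmod_ge_0 b); lra. }
specialize (Hd Hlt).
unfold Rdiv; rewrite Rabs_mult, Rabs_inv.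
apply Rmult_lt_reg_r with (Rabs h); [exact Hh0|].
rewrite Rmult_assoc, Rinv_l, Rmult_1_r by lra.
apply Rle_lt_trans with (Cmod c * (eps / K * (Rabs h * Cmod b))).
- apply Rle_trans with (1 := re_le_Cmod _). rewrite Cmod_mult.
  apply Rmult_le_compat_l; [apply Cmod_ge_0 | exact Hd].
- replace (Cmod c * (eps / K * (Rabs h * Cmod b)))
    with (eps * Rabs h * ((Cmod c * Cmod b) / K)) by (field; lra).
  rewrite <- (Rmult_1_r (eps * Rabs h)) at 2.
  apply Rmult_lt_compat_l; [nra|].
  apply Rmult_lt_reg_r with K; [lra|].
  unfold Rdiv; rewrite Rmult_assoc, Rinv_l by lra. unfold K; lra.
Qed.

Lemma mean_value_C (f f' : C -> C) (z w : C) (K : R) :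
  (forall v, Cmod (v - z) <= Cmod (w - z) -> is_derive f v (f' v) /\ Cmod (f' v) <= K) ->
  Cmod (f w - f z) <= K * Cmod (w - z).
Proof.
intros H.
(* Testing against the conjugate of the increment reduces to a real function. *)
set (D := (f w - f z)%C).
assert (Hb : Rabs (Re (Cconj D * f (z + 1 * (w - z)))%C - Re (Cconj D * f (z + 0 * (w - z)))%C)
             <= (Cmod D * (Cmod (w - z) * K)) * Rabs (1 - 0)).
{ apply (bounded_variation (fun s => Re (Cconj D * f (z + s * (w - z)))%C)
           (fun s => Re (Cconj D * ((w - z) * f' (z + s * (w - z))))%C)).
  intros t Ht.
  rewrite Rminus_0_r, Rminus_0_r, Rabs_R1 in Ht.
  destruct (H (z + t * (w - z))%C) as [H1 H2].
  { replace (z + t * (w - z) - z)%C with (t * (w - z))%C by ring.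
    rewrite Cmod_mult, Cmod_R. generalize (Cmod_ge_0 (w - z)); nra. }
  split.
  - apply is_derive_Re_line, H1.
  - apply Rle_trans with (1 := re_le_Cmod _).
    rewrite !Cmod_mult, Cmod_conj.
    apply Rmult_le_compat_l; [apply Cmod_ge_0|].
    apply Rmult_le_compat_l; [apply Cmod_ge_0 | exact H2]. }
replace (z + 1 * (w - z))%C with w in Hb by ring.
replace (z + 0 * (w - z))%C with z in Hb by ring.
replace (Re (Cconj D * f w)%C - Re (Cconj D * f z)%C) with (Cmod D ^ 2) in Hb.
2:{ rewrite Cmod2_alt. unfold D. simpl. ring. }
rewrite Rminus_0_r, Rabs_R1, Rmult_1_r in Hb.
assert (H0 := Cmod_ge_0 D).
(* The bound reads |D|^2 <= |D| K |w - z|, so |D| must be cancelled. If it is 0, the claim needs K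
   >= 0, which the bound on [f'] at z supplies. *)
destruct (Req_dec (Cmod D) 0) as [HD|HD].
- rewrite HD. destruct (H z) as [_ H2].
  { replace (z - z)%C with (RtoC 0) by ring. rewrite Cmod_0. apply Cmod_ge_0. }
  generalize (Cmod_ge_0 (f' z)) (Cmod_ge_0 (w - z)); nra.
- rewrite Rabs_pos_eq in Hb by nra.
  apply Rmult_le_reg_l with (Cmod D); nra.
Qed.

(** The mean value inequality is used twice: on v -> f v - (v - z) f' z, whose derivative is f' v -
    f' z, and on [f'] to bound that derivative by M |v - z|. This loses the usual factor 1/2, which
    is harmless here. *)
Lemma taylor_C (f f' f'' : C -> C) (z w : C) (M : R) :
  (forall v, Cmod (v - z) <= Cmod (w - z) ->
     is_derive f v (f' v) /\ is_derive f' v (f'' v) /\ Cmod (f'' v) <= M) ->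
  Cmod (f w - f z - (w - z) * f' z) <= M * Cmod (w - z) ^ 2.
Proof.
intros H.
replace (f w - f z - (w - z) * f' z)%C
  with ((f w - (w - z) * f' z) - (f z - (z - z) * f' z))%C by ring.
replace (M * Cmod (w - z) ^ 2) with ((M * Cmod (w - z)) * Cmod (w - z)) by ring.
apply (mean_value_C (fun v => f v - (v - z) * f' z)%C (fun v => f' v - f' z)%C).
intros v Hv; destruct (H v Hv) as [H1 _]; split.
- eapply is_derive_eq.
  + apply is_derive_Cminus; [exact H1|].
    apply is_derive_Cmult; [|apply is_derive_Cconst].
    apply is_derive_Cminus; [apply is_derive_Cid | apply is_derive_Cconst].
  + simpl; ring.
- apply Rle_trans with (M * Cmod (v - z)).
  + apply (mean_value_C f' f''). intros v' Hv'. apply H. lra.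
  + apply Rmult_le_compat_l; [|exact Hv].
    apply Rle_trans with (2 := proj2 (proj2 (H v Hv))). apply Cmod_ge_0.
Qed.

(** * Convergence of complex sequences *)

Definition Ccvg (u : nat -> C) (l : C) : Prop :=
  is_lim_seq (fun n => Cmod (u n - l)) 0.

Lemma Ccvg_squeeze (u : nat -> C) (l : C) (e : nat -> R) :
  (forall n, Cmod (u n - l) <= e n) -> is_lim_seq e 0 -> Ccvg u l.
Proof.
intros H He. unfold Ccvg.
apply is_lim_seq_le_le with (fun _ => 0) e; auto.
- intros n; split; [apply Cmod_ge_0 | apply H].
- apply is_lim_seq_const.
Qed.

(** Estimates bound moduli, whereas [CLim_seq] is defined by real and imaginary parts; this is the
    bridge between the two. *)
Lemma Ccvg_components (u : nat -> C) (l : C) :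
  Ccvg u l <-> is_lim_seq (fun n => Re (u n)) (Re l) /\ is_lim_seq (fun n => Im (u n)) (Im l).
Proof.
split.
- intros H; split.
  + apply is_lim_seq_ext with (fun n => Re (u n - l)%C + Re l); [intros n; unfold Re, Im; simpl; ring|].
    replace (Finite (Re l)) with (Finite (0 + Re l)) by (f_equal; ring).
    apply is_lim_seq_plus'; [|apply is_lim_seq_const].
    apply is_lim_seq_abs_0.
    apply is_lim_seq_le_le with (fun _ => 0) (fun n => Cmod (u n - l)); auto.
    * intros n; split; [apply Rabs_pos | apply re_le_Cmod].
    * apply is_lim_seq_const.
  + apply is_lim_seq_ext with (fun n => Im (u n - l)%C + Im l); [intros n; unfold Re, Im; simpl; ring|].
    replace (Finite (Im l)) with (Finite (0 + Im l)) by (f_equal; ring).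
    apply is_lim_seq_plus'; [|apply is_lim_seq_const].
    apply is_lim_seq_abs_0.
    apply is_lim_seq_le_le with (fun _ => 0) (fun n => Cmod (u n - l)); auto.
    * intros n; split; [apply Rabs_pos|].
      apply Rle_trans with (2 := Rmax_Cmod _), Rmax_r.
    * apply is_lim_seq_const.
- intros [H1 H2].
  apply Ccvg_squeeze with (fun n => Rabs (Re (u n) - Re l) + Rabs (Im (u n) - Im l)).
  + intros n.
    replace (u n - l)%C with (RtoC (Re (u n) - Re l) + Ci * RtoC (Im (u n) - Im l))%C.
    2:{ apply injective_projections; unfold Re, Im; simpl; ring. }
    apply Rle_trans with (1 := Cmod_triangle _ _).
    rewrite Cmod_mult, Cmod_Ci, !Cmod_R; lra.
  + replace (Finite 0) with (Finite (0 + 0)) by (f_equal; ring).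
    apply is_lim_seq_plus'; apply -> is_lim_seq_abs_0.
    * replace (Finite 0) with (Finite (Re l - Re l)) by (f_equal; ring).
      apply is_lim_seq_minus'; [exact H1 | apply is_lim_seq_const].
    * replace (Finite 0) with (Finite (Im l - Im l)) by (f_equal; ring).
      apply is_lim_seq_minus'; [exact H2 | apply is_lim_seq_const].
Qed.

Lemma CLim_seq_unique (u : nat -> C) (l : C) : Ccvg u l -> CLim_seq u = l.
Proof.
intros H; apply Ccvg_components in H; destruct H as [H1 H2].
unfold CLim_seq.
rewrite (is_lim_seq_unique _ _ H1), (is_lim_seq_unique _ _ H2).
now destruct l.
Qed.

Lemma Ccvg_ext_loc (u v : nat -> C) (l : C) :
  eventually (fun n => u n = v n) -> Ccvg u l -> Ccvg v l.
Proof.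
intros [N HN] H. apply is_lim_seq_ext_loc with (2 := H).
exists N; intros n Hn; now rewrite HN.
Qed.

Lemma Ccvg_const (c : C) : Ccvg (fun _ => c) c.
Proof.
apply Ccvg_components; split; apply is_lim_seq_const.
Qed.

Lemma Ccvg_minus (u v : nat -> C) (a b : C) :
  Ccvg u a -> Ccvg v b -> Ccvg (fun n => u n - v n)%C (a - b)%C.
Proof.
rewrite !Ccvg_components; intros [H1 H2] [H3 H4]; split.
- now apply (is_lim_seq_minus' (fun n => Re (u n)) (fun n => Re (v n))).
- now apply (is_lim_seq_minus' (fun n => Im (u n)) (fun n => Im (v n))).
Qed.

Lemma Ccvg_plus (u v : nat -> C) (a b : C) :
  Ccvg u a -> Ccvg v b -> Ccvg (fun n => u n + v n)%C (a + b)%C.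
Proof.
rewrite !Ccvg_components; intros [H1 H2] [H3 H4]; split.
- now apply (is_lim_seq_plus' (fun n => Re (u n)) (fun n => Re (v n))).
- now apply (is_lim_seq_plus' (fun n => Im (u n)) (fun n => Im (v n))).
Qed.

Lemma Ccvg_mult (u v : nat -> C) (a b : C) :
  Ccvg u a -> Ccvg v b -> Ccvg (fun n => u n * v n)%C (a * b)%C.
Proof.
rewrite !Ccvg_components; intros [H1 H2] [H3 H4]; split; simpl.
- apply is_lim_seq_minus'; apply is_lim_seq_mult'; assumption.
- apply is_lim_seq_plus'; apply is_lim_seq_mult'; assumption.
Qed.

Lemma Ccvg_Cmod (u : nat -> C) (l : C) : Ccvg u l -> is_lim_seq (fun n => Cmod (u n)) (Cmod l).
Proof.
intros H.
apply is_lim_seq_le_le with (fun n => Cmod l - Cmod (u n - l)) (fun n => Cmod l + Cmod (u n - l)).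
- intros n; split.
  + generalize (Cmod_triangle_lower l (u n)). rewrite Cmod_minus_sym. lra.
  + generalize (Cmod_triangle_lower (u n) l). lra.
- replace (Finite (Cmod l)) with (Finite (Cmod l - 0)) by (f_equal; ring).
  apply is_lim_seq_minus'; [apply is_lim_seq_const | exact H].
- replace (Finite (Cmod l)) with (Finite (Cmod l + 0)) by (f_equal; ring).
  apply is_lim_seq_plus'; [apply is_lim_seq_const | exact H].
Qed.

Lemma Ccvg_Cmod_le (u : nat -> C) (l : C) (K : R) :
  Ccvg u l -> eventually (fun n => Cmod (u n) <= K) -> Cmod l <= K.
Proof.
intros H HK.
apply (is_lim_seq_le_loc (fun n => Cmod (u n)) (fun _ => K) (Cmod l) K HK).
- now apply Ccvg_Cmod.
- apply is_lim_seq_const.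
Qed.

Lemma Ccvg_Cmod_ge (u : nat -> C) (l : C) (K : R) :
  Ccvg u l -> eventually (fun n => K <= Cmod (u n)) -> K <= Cmod l.
Proof.
intros H HK.
apply (is_lim_seq_le_loc (fun _ => K) (fun n => Cmod (u n)) K (Cmod l) HK).
- apply is_lim_seq_const.
- now apply Ccvg_Cmod.
Qed.

Lemma derive_of_limit (F F' F'' : nat -> C -> C) (f : C -> C) (z g : C) (r M : R) (N : nat) :
  0 < r ->
  (forall n v, (N <= n)%nat -> Cmod (v - z) < r ->
     is_derive (F n) v (F' n v) /\ is_derive (F' n) v (F'' n v) /\ Cmod (F'' n v) <= M) ->
  (forall v, Cmod (v - z) < r -> Ccvg (fun n => F n v) (f v)) ->
  Ccvg (fun n => F' n z) g ->
  is_derive f z g.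
Proof.
intros Hr HF Hf Hg.
assert (Hzz : Cmod (z - z) < r).
{ replace (z - z)%C with (RtoC 0) by ring. now rewrite Cmod_0. }
assert (HM : 0 <= M).
{ apply Rle_trans with (2 := proj2 (proj2 (HF N z (le_n _) Hzz))), Cmod_ge_0. }
assert (HT : forall w, Cmod (w - z) < r -> Cmod (f w - f z - (w - z) * g) <= M * Cmod (w - z) ^ 2).
{ intros w Hw.
  apply Ccvg_Cmod_le with (fun n => F n w - F n z - (w - z) * F' n z)%C.
  - apply Ccvg_minus; [apply Ccvg_minus; now apply Hf|].
    apply Ccvg_mult; [apply Ccvg_const | exact Hg].
  - exists N; intros n Hn.
    apply taylor_C with (F'' n). intros v Hv. apply HF; [exact Hn | lra]. }
apply is_derive_C_iff; intros eps.
(* [M + 1] replaces [M] because the bound M may be 0. *)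
assert (Hd : 0 < Rmin r (eps / (M + 1))).
{ apply Rmin_pos; [exact Hr|]. apply Rdiv_lt_0_compat; [apply cond_pos | lra]. }
exists (mkposreal _ Hd); simpl; intros w Hw.
assert (H1 := Rlt_le_trans _ _ _ Hw (Rmin_l _ _)).
assert (H2 := Rlt_le_trans _ _ _ Hw (Rmin_r _ _)).
apply Rle_trans with (1 := HT w H1).
assert (H0 := Cmod_ge_0 (w - z)).
replace (M * Cmod (w - z) ^ 2) with (M * Cmod (w - z) * Cmod (w - z)) by ring.
apply Rmult_le_compat_r; [exact H0|].
apply Rle_trans with ((M + 1) * (eps / (M + 1))).
- apply Rmult_le_compat; lra.
- apply Req_le; field; lra.
Qed.

(** * Sequences with increments of order 1/n^2 *)

Lemma inv_sqr_le_telescope (n : nat) : (1 <= n)%nat -> / INR (S n) ^ 2 <= / INR n - / INR (S n).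
Proof.
intros Hn. apply le_INR in Hn. rewrite S_INR in *. simpl in Hn.
replace (/ INR n - / (INR n + 1)) with (/ (INR n * (INR n + 1))) by (field; lra).
apply Rinv_le_contravar; nra.
Qed.

(** The comparison of 1/(n+1)^2 with 1/n - 1/(n+1) sums in closed form. The resulting bound gives
    both the Cauchy property and uniform boundedness. *)
Lemma Cmod_telescope (a : nat -> C) (K : R) (N : nat) :
  (1 <= N)%nat -> 0 <= K ->
  (forall n, (N <= n)%nat -> Cmod (a (S n) - a n) <= K / INR (S n) ^ 2) ->
  forall n m, (N <= n)%nat -> (n <= m)%nat ->
  Cmod (a m - a n) <= K * (/ INR n - / INR m).
Proof.
intros HN HK H n m Hn Hm.
induction Hm as [|m Hm IH].
- replace (a n - a n)%C with (RtoC 0) by ring. rewrite Cmod_0. lra.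
- replace (a (S m) - a n)%C with ((a (S m) - a m) + (a m - a n))%C by ring.
  apply Rle_trans with (1 := Cmod_triangle _ _).
  assert (H1 := H m ltac:(lia)).
  assert (H2 := inv_sqr_le_telescope m ltac:(lia)).
  unfold Rdiv in H1. nra.
Qed.

(** Reduces a bound for all n >= N to a bound at the single index N; this is how local bounds become
    uniform in n. *)
Lemma Cmod_le_of_increments (a : nat -> C) (K : R) (N : nat) :
  (1 <= N)%nat -> 0 <= K ->
  (forall n, (N <= n)%nat -> Cmod (a (S n) - a n) <= K / INR (S n) ^ 2) ->
  forall n, (N <= n)%nat -> Cmod (a n) <= Cmod (a N) + K.
Proof.
intros HN HK H n Hn.
assert (H1 := Cmod_telescope a K N HN HK H N n (le_n _) Hn).
assert (H2 := Cmod_triangle_lower (a n) (a N)).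
apply le_INR in HN. apply le_INR in Hn. simpl in HN.
assert (H3 : / INR N <= 1) by (rewrite <- Rinv_1; apply Rinv_le_contravar; lra).
assert (H4 : 0 < / INR n) by (apply Rinv_0_lt_compat; lra).
nra.
Qed.

Lemma is_lim_seq_inv_INR : is_lim_seq (fun n => / INR n) 0.
Proof.
apply is_lim_seq_spec. intros eps.
destruct (archimed_cor1 eps (cond_pos eps)) as [N [HN HN0]].
exists N; intros n Hn.
apply lt_INR in HN0. apply le_INR in Hn. simpl in HN0.
rewrite Rminus_0_r, Rabs_pos_eq by (left; apply Rinv_0_lt_compat; lra).
apply Rle_lt_trans with (2 := HN). apply Rinv_le_contravar; lra.
Qed.

Lemma Ccvg_of_increments (a : nat -> C) (K : R) (N : nat) :
  (1 <= N)%nat -> 0 <= K ->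
  (forall n, (N <= n)%nat -> Cmod (a (S n) - a n) <= K / INR (S n) ^ 2) ->
  exists l, Ccvg a l.
Proof.
intros HN HK H.
assert (HC : forall eps : posreal, exists N0 : nat, forall n m, (N0 <= n)%nat -> (N0 <= m)%nat ->
  Cmod (a n - a m) < eps).
{ intros eps.
  assert (He : 0 < eps / (K + 1)) by (apply Rdiv_lt_0_compat; [apply cond_pos | lra]).
  destruct (archimed_cor1 _ He) as [N1 [HN1 HN10]].
  assert (HW : forall n m, (Nat.max N N1 <= n)%nat -> (n <= m)%nat -> Cmod (a m - a n) < eps).
  { intros n m Hn Hm.
    apply Rle_lt_trans with (1 := Cmod_telescope a K N HN HK H n m ltac:(lia) Hm).
    assert (Hn1 : INR N1 <= INR n) by (apply le_INR; lia).
    assert (Hm1 : INR n <= INR m) by (apply le_INR; lia).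
    apply lt_INR in HN10. simpl in HN10.
    assert (0 < / INR m) by (apply Rinv_0_lt_compat; lra).
    assert (/ INR n <= / INR N1) by (apply Rinv_le_contravar; lra).
    assert (0 < / INR n) by (apply Rinv_0_lt_compat; lra).
    apply Rle_lt_trans with ((K + 1) * / INR N1 - / INR n); [nra|].
    apply Rlt_le_trans with ((K + 1) * (eps / (K + 1))); [nra|].
    apply Req_le; field; lra. }
  exists (Nat.max N N1); intros n m Hn Hm.
  destruct (Nat.le_ge_cases n m) as [Hnm|Hnm].
  - rewrite Cmod_minus_sym. now apply HW.
  - now apply HW. }
assert (H1 : ex_finite_lim_seq (fun n => Re (a n))).
{ apply ex_lim_seq_cauchy_corr. intros eps. destruct (HC eps) as [N0 HN0].
  exists N0; intros n m Hn Hm. apply Rle_lt_trans with (2 := HN0 n m Hn Hm).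
  exact (re_le_Cmod (a n - a m)). }
assert (H2 : ex_finite_lim_seq (fun n => Im (a n))).
{ apply ex_lim_seq_cauchy_corr. intros eps. destruct (HC eps) as [N0 HN0].
  exists N0; intros n m Hn Hm. apply Rle_lt_trans with (2 := HN0 n m Hn Hm).
  apply Rle_trans with (2 := Rmax_Cmod (a n - a m)%C). exact (Rmax_r _ _). }
destruct H1 as [x Hx], H2 as [y Hy].
exists (x, y). now apply Ccvg_components.
Qed.

(** Multiplicative counterpart for increments controlled relative to the current size: 1 + t <= exp
    t turns the product of the factors into the exponential of a telescoping sum, of total at most
    K. *)
Lemma growth_bound (a : nat -> R) (K : R) (N : nat) :
  (1 <= N)%nat -> 0 <= K -> (forall n, 0 <= a n) ->
  (forall n, (N <= n)%nat -> a (S n) <= a n * (1 + K / INR (S n) ^ 2)) ->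
  forall n, (N <= n)%nat -> a n <= a N * exp K.
Proof.
intros HN HK Ha H n Hn.
assert (HN1 : 1 <= INR N) by (apply (le_INR 1); exact HN).
assert (Hn1 : INR N <= INR n) by (apply le_INR; exact Hn).
apply Rle_trans with (a N * exp (K * (/ INR N - / INR n))).
- clear Hn1. induction Hn as [|n Hn IH].
  + rewrite Rminus_diag, Rmult_0_r, exp_0. lra.
  + apply Rle_trans with (1 := H n Hn).
    apply Rle_trans with (a N * exp (K * (/ INR N - / INR n)) * exp (K * (/ INR n - / INR (S n)))).
    * apply Rmult_le_compat; [apply Ha | | exact IH |].
      { assert (0 <= K / INR (S n) ^ 2); [|lra].
        apply Rle_mult_inv_pos; [lra|]. apply pow_lt. apply lt_0_INR; lia. }
      apply Rle_trans with (1 + K * (/ INR n - / INR (S n))); [|apply exp_ineq1_le].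
      apply Rplus_le_compat_l, Rmult_le_compat_l; [exact HK|].
      apply inv_sqr_le_telescope; lia.
    * rewrite Rmult_assoc, <- exp_plus. apply Req_le. do 2 f_equal. ring.
- apply Rmult_le_compat_l; [apply Ha|].
  assert (/ INR N <= 1) by (rewrite <- Rinv_1; apply Rinv_le_contravar; lra).
  assert (0 < / INR n) by (apply Rinv_0_lt_compat; lra).
  assert (Hle : K * (/ INR N - / INR n) <= K) by nra.
  destruct Hle as [Hlt|He]; [left; now apply exp_increasing | rewrite He; lra].
Qed.

(** * Gauss's product and the digamma function *)

Lemma Cexp_plus (a b : C) : Cexp (a + b) = (Cexp a * Cexp b)%C.
Proof.
unfold Cexp, Cmult; simpl. rewrite exp_plus, cos_plus, sin_plus.
f_equal; unfold Re, Im; ring.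
Qed.

Lemma Cexp_0 : Cexp 0 = RtoC 1.
Proof.
unfold Cexp; simpl. rewrite exp_0, cos_0, sin_0. unfold RtoC; f_equal; ring.
Qed.

Lemma Cexp_nz (z : C) : Cexp z <> 0.
Proof.
intros H. apply C1_nz. rewrite <- Cexp_0.
replace (RtoC 0) with (z + - z)%C by ring.
rewrite Cexp_plus, H. ring.
Qed.

Lemma exp_second_order (a : R) : Rabs a <= 1 / 2 -> 0 <= exp a - 1 - a <= 2 * a ^ 2.
Proof.
intros Ha; apply Rabs_le_between in Ha.
assert (H1 := exp_ineq1_le a). assert (H2 := exp_ineq1_le (- a)).
assert (H3 : exp a * exp (- a) = 1).
{ rewrite <- exp_plus, Rplus_opp_r. apply exp_0. }
split; [lra|].
(* 1 - a <= exp (-a) gives the upper bound exp a <= 1/(1 - a), from which the quadratic estimate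
   follows for |a| <= 1/2. *)
assert (H4 : exp a * (1 - a) <= 1) by (generalize (exp_pos a); nra).
apply Rmult_le_reg_r with (1 - a); [lra|]. nra.
Qed.

Lemma cos_second_order (b : R) : 0 <= 1 - cos b <= b ^ 2 / 2.
Proof.
split; [generalize (COS_bound b); lra|].
replace b with (2 * (b / 2)) at 1 by field.
rewrite cos_2a_sin.
assert (H : Rabs (sin (b / 2)) <= Rabs (b / 2)).
{ replace (sin (b / 2)) with (sin (b / 2) - sin 0) by (rewrite sin_0; ring).
  replace (Rabs (b / 2)) with (1 * Rabs (b / 2 - 0)) by (rewrite Rminus_0_r; ring).
  apply bounded_variation with cos. intros t _; split; [apply is_derive_sin|].
  apply Rabs_le, COS_bound. }
apply Rsqr_le_abs_1 in H. unfold Rsqr in H. lra.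
Qed.

(** Mean value inequality for sin t - t: its derivative cos t - 1 is at most b^2/2 in absolute value
    when |t| <= |b|. *)
Lemma sin_third_order (b : R) : Rabs (sin b - b) <= b ^ 2 / 2 * Rabs b.
Proof.
replace (sin b - b) with ((sin b - b) - (sin 0 - 0)) by (rewrite sin_0; ring).
replace (Rabs b) with (Rabs (b - 0)) by (f_equal; ring).
apply (bounded_variation (fun t => sin t - t) (fun t => cos t - 1)).
intros t Ht; split.
- apply (is_derive_minus (K := R_AbsRing) (V := R_NormedModule));
    [apply is_derive_sin | apply (is_derive_id (K := R_AbsRing))].
- rewrite !Rminus_0_r in Ht. apply Rsqr_le_abs_1 in Ht. unfold Rsqr in Ht.
  generalize (cos_second_order t); intros. rewrite Rabs_minus_sym, Rabs_pos_eq; lra.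
Qed.

Lemma Cmod_le_Re_Im (z : C) : Cmod z <= Rabs (Re z) + Rabs (Im z).
Proof.
replace z with (RtoC (Re z) + Ci * RtoC (Im z))%C at 1.
2:{ apply injective_projections; unfold Re, Im; simpl; ring. }
apply Rle_trans with (1 := Cmod_triangle _ _).
rewrite Cmod_mult, Cmod_Ci, !Cmod_R; lra.
Qed.

(** Serves twice: it gives the derivative of [Cexp], and it controls the factor by which Gauss's
    approximant changes from n to n+1. The two components contribute at most 3 a^2 + (5/2) b^2 with
    h = a + ib, hence the constant 4. *)
Lemma Cexp_second_order (h : C) :
  Cmod h <= 1 / 2 -> Cmod (Cexp h - 1 - h) <= 4 * Cmod h ^ 2.
Proof.
intros Hh. rewrite Cmod2_alt.
assert (Ha := Rle_trans _ _ _ (re_le_Cmod h) Hh).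
assert (Hb : Rabs (Im h) <= 1 / 2).
{ apply Rle_trans with (2 := Hh). apply Rle_trans with (2 := Rmax_Cmod h). apply Rmax_r. }
apply Rle_trans with (1 := Cmod_le_Re_Im _).
replace (Re (Cexp h - 1 - h)%C) with (exp (Re h) * cos (Im h) - 1 - Re h)
  by (unfold Cexp, Re, Im; simpl; ring).
replace (Im (Cexp h - 1 - h)%C) with (exp (Re h) * sin (Im h) - Im h)
  by (unfold Cexp, Re, Im; simpl; ring).
set (a := Re h) in *. set (b := Im h) in *.
assert (H1 := exp_second_order a Ha).
assert (H2 := cos_second_order b).
assert (H3 := sin_third_order b).
assert (Ha' := Ha). apply Rabs_le_between in Ha'.
assert (Hb' := Hb). apply Rabs_le_between in Hb'.
assert (He : 0 < exp a <= 2) by (generalize (exp_pos a); nra).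
assert (E1 : Rabs (exp a * cos b - 1 - a) <= b ^ 2 + 2 * a ^ 2).
{ replace (exp a * cos b - 1 - a) with ((exp a - 1 - a) - exp a * (1 - cos b)) by ring.
  apply Rabs_le. nra. }
assert (E2 : Rabs (exp a * sin b - b) <= b ^ 2 / 2 + (a ^ 2 + b ^ 2)).
{ replace (exp a * sin b - b) with (exp a * (sin b - b) + (exp a - 1) * b) by ring.
  apply Rle_trans with (1 := Rabs_triang _ _). apply Rplus_le_compat.
  - rewrite Rabs_mult, (Rabs_pos_eq (exp a)) by lra.
    apply Rle_trans with (2 * (b ^ 2 / 2 * Rabs b)).
    + apply Rmult_le_compat; try lra. apply Rabs_pos.
    + generalize (pow2_ge_0 b); nra.
  - rewrite Rabs_mult.
    assert (Rabs (exp a - 1) <= 2 * Rabs a).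
    { apply Rabs_le. destruct (Rle_lt_dec 0 a).
      - rewrite Rabs_pos_eq by lra. nra.
      - rewrite Rabs_left by lra. nra. }
    rewrite <- (pow2_abs a), <- (pow2_abs b).
    assert (0 <= Rabs a) by apply Rabs_pos. assert (0 <= Rabs b) by apply Rabs_pos.
    apply Rle_trans with (2 * Rabs a * Rabs b); [apply Rmult_le_compat_r; lra|].
    generalize (pow2_ge_0 (Rabs a - Rabs b)); lra. }
generalize (pow2_ge_0 a) (pow2_ge_0 b); lra.
Qed.

Lemma is_derive_Cexp (z : C) : is_derive Cexp z (Cexp z).
Proof.
apply is_derive_C_iff; intros eps.
assert (HK : 0 < Cmod (Cexp z)) by apply Cmod_gt_0, Cexp_nz.
assert (Hd : 0 < Rmin (1 / 2) (eps / (4 * Cmod (Cexp z)))).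
{ apply Rmin_pos; [lra | apply Rdiv_lt_0_compat; [apply cond_pos | lra]]. }
exists (mkposreal _ Hd); simpl; intros w Hw.
assert (H1 := Rlt_le_trans _ _ _ Hw (Rmin_l _ _)).
assert (H2 := Rlt_le_trans _ _ _ Hw (Rmin_r _ _)).
replace (Cexp w) with (Cexp z * Cexp (w - z))%C
  by (rewrite <- Cexp_plus; f_equal; ring).
replace (Cexp z * Cexp (w - z) - Cexp z - (w - z) * Cexp z)%C
  with (Cexp z * (Cexp (w - z) - 1 - (w - z)))%C by ring.
rewrite Cmod_mult.
assert (H3 := Cexp_second_order (w - z) ltac:(lra)).
assert (H0 := Cmod_ge_0 (w - z)).
apply Rle_trans with (Cmod (Cexp z) * (4 * Cmod (w - z) ^ 2)).
- apply Rmult_le_compat_l; lra.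
- replace (Cmod (Cexp z) * (4 * Cmod (w - z) ^ 2))
    with (4 * Cmod (Cexp z) * Cmod (w - z) * Cmod (w - z)) by ring.
  apply Rmult_le_compat_r; [exact H0|].
  apply Rle_trans with (4 * Cmod (Cexp z) * (eps / (4 * Cmod (Cexp z)))).
  + apply Rmult_le_compat_l; lra.
  + apply Req_le; field; lra.
Qed.

Lemma ln_le_minus_1 (x : R) : 0 < x -> ln x <= x - 1.
Proof. intros Hx. generalize (exp_ineq1_le (ln x)). rewrite exp_ln by exact Hx. lra. Qed.

Lemma ln_succ_bounds (n : nat) : (1 <= n)%nat ->
  / INR (S n) <= ln (INR (S n)) - ln (INR n) <= / INR n.
Proof.
intros Hn; apply (le_INR 1) in Hn; simpl INR in Hn at 1; rewrite S_INR.
rewrite <- ln_div by lra. split.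
- replace ((INR n + 1) / INR n) with (/ (INR n / (INR n + 1))) by (field; lra).
  rewrite ln_Rinv by (apply Rdiv_lt_0_compat; lra).
  assert (H := ln_le_minus_1 (INR n / (INR n + 1)) ltac:(apply Rdiv_lt_0_compat; lra)).
  replace (INR n / (INR n + 1) - 1) with (- / (INR n + 1)) in H by (field; lra). lra.
- assert (H := ln_le_minus_1 ((INR n + 1) / INR n) ltac:(apply Rdiv_lt_0_compat; lra)).
  replace ((INR n + 1) / INR n - 1) with (/ INR n) in H by (field; lra). lra.
Qed.

(** The first bound makes v (ln (n+1) - ln n) small enough for [Cexp_second_order]; the second is
    the cancellation of the logarithm against 1/(n+1) that makes Gauss's product converge. The
    factor 2 comes from 1/n <= 2/(n+1). *)
Lemma ln_succ_approx (n : nat) : (1 <= n)%nat ->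
  0 <= ln (INR (S n)) - ln (INR n) <= 2 / INR (S n) /\
  Rabs (ln (INR (S n)) - ln (INR n) - / INR (S n)) <= 2 / INR (S n) ^ 2.
Proof.
intros Hn; assert (H := ln_succ_bounds n Hn).
apply (le_INR 1) in Hn; simpl INR in Hn at 1.
set (l := ln (INR (S n)) - ln (INR n)) in *.
rewrite S_INR in *.
assert (H0 : 0 < / (INR n + 1)) by (apply Rinv_0_lt_compat; lra).
assert (H1 : / INR n <= 2 / (INR n + 1)).
{ apply Rmult_le_reg_r with (INR n * (INR n + 1)); [nra|].
  replace (/ INR n * (INR n * (INR n + 1))) with (INR n + 1) by (field; lra).
  replace (2 / (INR n + 1) * (INR n * (INR n + 1))) with (2 * INR n) by (field; lra). lra. }
assert (H2 : / INR n - / (INR n + 1) <= 2 / (INR n + 1) ^ 2).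
{ replace (/ INR n - / (INR n + 1)) with (/ INR n * / (INR n + 1)) by (field; lra).
  replace (2 / (INR n + 1) ^ 2) with (2 / (INR n + 1) * / (INR n + 1)) by (field; lra).
  apply Rmult_le_compat_r; lra. }
split; [lra|]. rewrite Rabs_pos_eq; lra.
Qed.

(** * Gauss's approximants and their logarithmic derivatives *)

Definition non_pole (z : C) : Prop := forall j : nat, (z + INR j)%C <> 0.

(** Verbatim the sequence inside [CGamma], so that its limit is the value of [CGamma] by
    conversion. *)
Definition gauss (n : nat) (z : C) : C :=
  (INR (fact n) * Cexp (z * ln (INR n)) / Cprod (fun j => z + INR j) (S n))%C.

(* The primes count the derivatives of log (gauss n). *)
Definition gauss_log' (n : nat) (z : C) : C :=
  (ln (INR n) - sum_n (fun j => / (z + INR j)) n)%C.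

Definition gauss_log'' (n : nat) (z : C) : C :=
  sum_n (fun j => / ((z + INR j) * (z + INR j)))%C n.

Definition gauss_log''' (n : nat) (z : C) : C :=
  sum_n (fun j => - (2 / ((z + INR j) * (z + INR j) * (z + INR j))))%C n.

Lemma Cprod_nz (f : nat -> C) (n : nat) :
  (forall j, (j < n)%nat -> f j <> 0) -> Cprod f n <> 0.
Proof.
induction n as [|n IH]; intros H; simpl.
- apply C1_nz.
- apply Cmult_neq_0; [apply IH; intros; apply H; lia | apply H; lia].
Qed.

Lemma is_derive_shift (c z : C) : is_derive (fun w => w + c)%C z (RtoC 1).
Proof.
eapply is_derive_eq.
- apply is_derive_Cplus; [apply is_derive_Cid | apply is_derive_Cconst].
- ring.
Qed.

Lemma is_derive_Cinv_comp (f : C -> C) (z df : C) :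
  f z <> 0 -> is_derive f z df -> is_derive (fun w => / f w)%C z (- df / (f z * f z))%C.
Proof.
intros Hz Hf. eapply is_derive_eq.
- apply (is_derive_Ccomp (fun w => / w)%C f); [now apply is_derive_Cinv | exact Hf].
- field; exact Hz.
Qed.

Lemma is_derive_Cprod (f : nat -> C -> C) (f' : nat -> C) (z : C) (n : nat) :
  (forall j, is_derive (f j) z (f' j)) -> (forall j, f j z <> 0) ->
  is_derive (fun w => Cprod (fun j => f j w) (S n)) z
    (Cprod (fun j => f j z) (S n) * sum_n (fun j => f' j / f j z) n)%C.
Proof.
intros Hf Hz; induction n as [|n IH].
- apply is_derive_ext with (fun w => 1 * f O w)%C; [reflexivity|].
  eapply is_derive_eq.
  + apply is_derive_Cmult; [apply is_derive_Cconst | apply Hf].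
  + rewrite sum_O. simpl. field. apply Hz.
- apply is_derive_ext with (fun w => Cprod (fun j => f j w) (S n) * f (S n) w)%C; [reflexivity|].
  eapply is_derive_eq.
  + apply is_derive_Cmult; [apply IH | apply Hf].
  + cbv beta. rewrite sum_Sn.
    change (plus (sum_n (fun j => f' j / f j z)%C n) (f' (S n) / f (S n) z))%C
      with (sum_n (fun j => f' j / f j z)%C n + f' (S n) / f (S n) z)%C.
    change (Cprod (fun j => f j z) (S (S n))) with (Cprod (fun j => f j z) (S n) * f (S n) z)%C.
    field. apply Hz.
Qed.

Lemma is_derive_gauss (n : nat) (z : C) :
  non_pole z -> is_derive (gauss n) z (gauss n z * gauss_log' n z)%C.
Proof.
intros Hz.
assert (HP : Cprod (fun j => z + INR j)%C (S n) <> 0) by (apply Cprod_nz; intros; apply Hz).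
unfold gauss, Cdiv. eapply is_derive_eq.
- apply is_derive_Cmult.
  + apply is_derive_Cmult; [apply is_derive_Cconst|].
    apply (is_derive_Ccomp Cexp (fun w => w * ln (INR n))%C); [apply is_derive_Cexp|].
    apply is_derive_Cmult; [apply is_derive_Cid | apply is_derive_Cconst].
  + apply is_derive_Cinv_comp; [exact HP|].
    apply (is_derive_Cprod (fun j w => w + INR j)%C (fun _ => RtoC 1)).
    * intros j; apply is_derive_shift.
    * apply Hz.
- unfold gauss_log'. cbv beta.
  rewrite (sum_n_ext (fun j => 1 / (z + INR j))%C (fun j => / (z + INR j))%C).
  2:{ intros j. unfold Cdiv. apply Cmult_1_l. }
  generalize dependent (Cprod (fun j => z + INR j)%C (S n)). intros p Hp.
  generalize (sum_n (fun j => / (z + INR j))%C n); intros s.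
  field. exact Hp.
Qed.

Lemma is_derive_gauss_log' (n : nat) (z : C) :
  non_pole z -> is_derive (gauss_log' n) z (gauss_log'' n z).
Proof.
intros Hz. unfold gauss_log', gauss_log''. eapply is_derive_eq.
- apply is_derive_Cminus; [apply is_derive_Cconst|].
  apply (is_derive_sum_n (fun j w => / (w + INR j))%C n z
    (fun j => - RtoC 1 / ((z + INR j) * (z + INR j)))%C).
  intros j _; apply (is_derive_Cinv_comp (fun w => w + INR j)%C); [apply Hz | apply is_derive_shift].
- induction n as [|n IH].
  + rewrite !sum_O. field. apply Hz.
  + rewrite !sum_Sn, <- IH. change plus with Cplus. field. apply Hz.
Qed.

Lemma is_derive_gauss_log'' (n : nat) (z : C) :
  non_pole z -> is_derive (gauss_log'' n) z (gauss_log''' n z).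
Proof.
intros Hz. unfold gauss_log''.
apply (is_derive_sum_n (fun j w => / ((w + INR j) * (w + INR j)))%C n z
    (fun j => - (2 / ((z + INR j) * (z + INR j) * (z + INR j))))%C).
intros j _. eapply is_derive_eq.
- apply (is_derive_Cinv_comp (fun w => (w + INR j) * (w + INR j))%C).
  + apply Cmult_neq_0; apply Hz.
  + apply is_derive_Cmult; apply is_derive_shift.
- cbv beta. field. apply Hz.
Qed.

(** Source of the uniformity in v: on the disc of radius B, all denominators with index n >= 2B are
    bounded below by n/2. *)
Lemma Cmod_shift_ge (v : C) (B : R) (n : nat) :
  Cmod v <= B -> 2 * B <= INR n -> INR n / 2 <= Cmod (v + INR n).
Proof.
intros Hv Hn.
assert (H := Cmod_triangle_lower (INR n) (- v)).
rewrite Cmod_opp, Cmod_R, Rabs_pos_eq in H by apply pos_INR.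
replace (INR n - - v)%C with (v + INR n)%C in H by ring. lra.
Qed.

Lemma INR_S_pos (n : nat) : 0 < INR (S n).
Proof. apply lt_0_INR; lia. Qed.

Lemma gauss_log'_step (v : C) (B : R) (n : nat) : (1 <= n)%nat ->
  Cmod v <= B -> 2 * B <= INR n ->
  Cmod (gauss_log' (S n) v - gauss_log' n v) <= (2 + 2 * B) / INR (S n) ^ 2.
Proof.
intros Hn Hv HB.
assert (Hs := INR_S_pos n).
assert (Hge : INR (S n) / 2 <= Cmod (v + INR (S n))).
{ apply Cmod_shift_ge with B; [exact Hv|]. rewrite S_INR; lra. }
assert (H0 : (v + INR (S n))%C <> 0) by (apply Cmod_gt_0; lra).
assert (H1 : RtoC (INR (S n)) <> 0) by (intros H; apply RtoC_inj in H; lra).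
unfold gauss_log'. rewrite sum_Sn. change plus with Cplus.
set (s := sum_n _ n).
(* Inserting 1/(n+1) separates the error of the logarithm, at most 2/(n+1)^2, from 1/(n+1) -
   1/(v+n+1), at most 2B/(n+1)^2. *)
replace (ln (INR (S n)) - (s + / (v + INR (S n))) - (ln (INR n) - s))%C
  with (RtoC (ln (INR (S n)) - ln (INR n) - / INR (S n)) + v / (INR (S n) * (v + INR (S n))))%C.
2:{ rewrite !RtoC_minus, RtoC_inv by lra. field. split; assumption. }
apply Rle_trans with (1 := Cmod_triangle _ _).
replace ((2 + 2 * B) / INR (S n) ^ 2) with (2 / INR (S n) ^ 2 + B * (/ INR (S n) * (2 / INR (S n)))).
2:{ field. lra. }
apply Rplus_le_compat.
- rewrite Cmod_R. now apply ln_succ_approx.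
- rewrite Cmod_div, Cmod_mult, Cmod_R, Rabs_pos_eq by (first [lra | now apply Cmult_neq_0]).
  unfold Rdiv at 1. rewrite Rinv_mult.
  assert (H2 : / Cmod (v + INR (S n)) <= 2 / INR (S n)).
  { replace (2 / INR (S n)) with (/ (INR (S n) / 2)) by (field; lra).
    apply Rinv_le_contravar; lra. }
  assert (0 < / Cmod (v + INR (S n))) by (apply Rinv_0_lt_compat; lra).
  assert (0 < / INR (S n)) by (apply Rinv_0_lt_compat; lra).
  assert (0 <= Cmod v) by apply Cmod_ge_0.
  apply Rmult_le_compat; [lra | nra | lra |].
  apply Rmult_le_compat_l; lra.
Qed.

Lemma gauss_log''_step (v : C) (B : R) (n : nat) :
  Cmod v <= B -> 2 * B <= INR n ->
  Cmod (gauss_log'' (S n) v - gauss_log'' n v) <= 4 / INR (S n) ^ 2.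
Proof.
intros Hv HB.
assert (Hs := INR_S_pos n).
assert (Hge : INR (S n) / 2 <= Cmod (v + INR (S n))).
{ apply Cmod_shift_ge with B; [exact Hv|]. rewrite S_INR; lra. }
assert (H0 : (v + INR (S n))%C <> 0) by (apply Cmod_gt_0; lra).
unfold gauss_log''. rewrite sum_Sn. change plus with Cplus.
set (s := sum_n _ n).
replace (s + / ((v + INR (S n)) * (v + INR (S n))) - s)%C
  with (/ ((v + INR (S n)) * (v + INR (S n))))%C by ring.
rewrite Cmod_inv, Cmod_mult by now apply Cmult_neq_0.
replace (4 / INR (S n) ^ 2) with (/ (INR (S n) / 2 * (INR (S n) / 2))) by (field; lra).
apply Rinv_le_contravar; nra.
Qed.

Lemma gauss_log'''_step (v : C) (B : R) (n : nat) :
  Cmod v <= B -> 2 * B <= INR n ->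
  Cmod (gauss_log''' (S n) v - gauss_log''' n v) <= 16 / INR (S n) ^ 2.
Proof.
intros Hv HB.
assert (Hs := INR_S_pos n).
assert (Hge : INR (S n) / 2 <= Cmod (v + INR (S n))).
{ apply Cmod_shift_ge with B; [exact Hv|]. rewrite S_INR; lra. }
assert (H0 : (v + INR (S n))%C <> 0) by (apply Cmod_gt_0; lra).
unfold gauss_log'''. rewrite sum_Sn. change plus with Cplus.
set (s := sum_n _ n). set (x := (v + INR (S n))%C) in *.
replace (s + - (2 / (x * x * x)) - s)%C with (- (2 / (x * x * x)))%C by ring.
rewrite Cmod_opp, Cmod_div, !Cmod_mult, Cmod_R, Rabs_pos_eq by (try lra; repeat apply Cmult_neq_0; auto).
assert (H1 : 1 <= INR (S n)) by (rewrite S_INR; generalize (pos_INR n); lra).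
(* The third factor is bounded below only by 1/2: this fits the cubic decay into the common
   1/(n+1)^2 form and produces 16. *)
apply Rle_trans with (2 / (INR (S n) / 2 * (INR (S n) / 2) * (1 / 2))).
- apply Rmult_le_compat_l; [lra|].
  apply Rinv_le_contravar; [repeat apply Rmult_lt_0_compat; lra|].
  apply Rmult_le_compat; try lra; [nra|].
  apply Rmult_le_compat; lra.
- apply Req_le; field; lra.
Qed.

Lemma gauss_S (n : nat) (v : C) : non_pole v ->
  gauss (S n) v = (gauss n v * (INR (S n) * Cexp (v * (ln (INR (S n)) - ln (INR n))) / (v + INR (S n))))%C.
Proof.
intros Hv.
assert (HP : Cprod (fun j => v + INR j)%C (S n) <> 0) by (apply Cprod_nz; intros; apply Hv).
unfold gauss.
change (Cprod (fun j => v + INR j)%C (S (S n))) with (Cprod (fun j => v + INR j) (S n) * (v + INR (S n)))%C.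
generalize dependent (Cprod (fun j => v + INR j)%C (S n)); intros p Hp.
replace (v * ln (INR (S n)))%C with (v * ln (INR n) + v * (ln (INR (S n)) - ln (INR n)))%C by ring.
rewrite Cexp_plus.
replace (fact (S n)) with (S n * fact n)%nat by reflexivity.
rewrite mult_INR, RtoC_mult.
field. split; [apply Hv | exact Hp].
Qed.

Lemma gauss_nz (n : nat) (v : C) : non_pole v -> gauss n v <> 0.
Proof.
intros Hv. unfold gauss, Cdiv.
apply Cmult_neq_0; [apply Cmult_neq_0|].
- intros H; apply RtoC_inj in H. exact (INR_fact_neq_0 _ H).
- apply Cexp_nz.
- assert (H : Cprod (fun j => v + INR j)%C (S n) <> 0) by (apply Cprod_nz; intros; apply Hv).
  intros H1. apply C1_nz. rewrite <- (Cinv_r _ H), H1. ring.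
Qed.

(** With s = n+1 and l = ln s - ln n, the ratio of consecutive approximants minus 1 is (s (exp(vl) -
    1 - vl) + v s (l - 1/s)) / (v + s). The numerator is at most 16 B^2/s + 2 B/s and the
    denominator at least s/2. The condition 4B <= n gives |vl| <= 1/2. *)
Lemma gauss_step (v : C) (B : R) (n : nat) : (1 <= n)%nat ->
  non_pole v -> Cmod v <= B -> 4 * B <= INR n ->
  Cmod (gauss (S n) v - gauss n v) <= Cmod (gauss n v) * ((32 * B ^ 2 + 4 * B) / INR (S n) ^ 2).
Proof.
intros Hn Hp Hv HB.
assert (Hv0 := Cmod_ge_0 v).
assert (Hs := INR_S_pos n).
assert (Hge : INR (S n) / 2 <= Cmod (v + INR (S n))).
{ apply Cmod_shift_ge with B; [exact Hv|]. rewrite S_INR; lra. }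
destruct (ln_succ_approx n Hn) as [Hl1 Hl2].
rewrite (gauss_S n v Hp), <- RtoC_minus.
set (l := ln (INR (S n)) - ln (INR n)) in *.
assert (H0 := Hp (S n)).
assert (Hvl : Cmod (v * l) <= B * (2 / INR (S n))).
{ rewrite Cmod_mult, Cmod_R, Rabs_pos_eq by lra. apply Rmult_le_compat; lra. }
assert (Hvl2 : B * (2 / INR (S n)) <= 1 / 2).
{ apply Rmult_le_reg_r with (INR (S n)); [lra|].
  replace (B * (2 / INR (S n)) * INR (S n)) with (2 * B) by (field; lra).
  rewrite S_INR; lra. }
assert (He := Cexp_second_order (v * l) ltac:(lra)).
replace (gauss n v * (INR (S n) * Cexp (v * l) / (v + INR (S n))) - gauss n v)%C
  with (gauss n v * ((INR (S n) * (Cexp (v * l) - 1 - v * l) + v * (INR (S n) * (l - / INR (S n)))) / (v + INR (S n))))%C.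
2:{ field. split; [exact H0 | intros H; apply RtoC_inj in H; lra]. }
rewrite Cmod_mult. apply Rmult_le_compat_l; [apply Cmod_ge_0|].
rewrite Cmod_div by exact H0.
apply Rmult_le_reg_r with (Cmod (v + INR (S n))); [lra|].
unfold Rdiv at 1; rewrite Rmult_assoc, Rinv_l, Rmult_1_r by lra.
apply Rle_trans with ((32 * B ^ 2 + 4 * B) / INR (S n) ^ 2 * (INR (S n) / 2)).
2:{ apply Rmult_le_compat_l; [|exact Hge].
    apply Rle_mult_inv_pos; [nra|]. now apply pow_lt. }
apply Rle_trans with (1 := Cmod_triangle _ _).
rewrite <- RtoC_inv, <- RtoC_minus, !Cmod_mult, !Cmod_R, (Rabs_pos_eq (INR (S n))) by lra.
replace ((32 * B ^ 2 + 4 * B) / INR (S n) ^ 2 * (INR (S n) / 2))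
  with (INR (S n) * (4 * (B * (2 / INR (S n))) ^ 2) + B * (INR (S n) * (2 / INR (S n) ^ 2))).
2:{ field; lra. }
apply Rplus_le_compat.
- apply Rmult_le_compat_l; [lra|]. apply Rle_trans with (1 := He).
  apply Rmult_le_compat_l; [lra|]. apply pow_incr. split; [apply Cmod_ge_0 | exact Hvl].
- apply Rmult_le_compat; try lra.
  + apply Rmult_le_pos; [lra | apply Rabs_pos].
  + apply Rmult_le_compat_l; lra.
Qed.

Lemma gauss_upper (v : C) (B : R) (N : nat) : (1 <= N)%nat ->
  non_pole v -> Cmod v <= B -> 4 * B <= INR N ->
  forall n, (N <= n)%nat -> Cmod (gauss n v) <= Cmod (gauss N v) * exp (32 * B ^ 2 + 4 * B).
Proof.
intros HN Hp Hv HB.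
assert (Hv0 := Cmod_ge_0 v).
apply (growth_bound (fun n => Cmod (gauss n v))); [exact HN | nra | intros; apply Cmod_ge_0 |].
intros n Hn.
assert (Hn' := le_INR _ _ Hn).
assert (H := gauss_step v B n ltac:(lia) Hp Hv ltac:(lra)).
assert (H1 := Cmod_triangle_lower (gauss (S n) v) (gauss n v)). lra.
Qed.

(** Keeps the limit away from 0, so that [CGamma] can be cancelled in [digamma]. *)
Lemma gauss_lower (v : C) (B : R) (N : nat) : (1 <= N)%nat ->
  non_pole v -> Cmod v <= B -> 4 * B <= INR N -> 2 * (32 * B ^ 2 + 4 * B) <= INR N ->
  forall n, (N <= n)%nat ->
  Cmod (gauss N v) * / exp (2 * (32 * B ^ 2 + 4 * B)) <= Cmod (gauss n v).
Proof.
intros HN Hp Hv HB HK n Hn.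
assert (Hv0 := Cmod_ge_0 v).
assert (Hpos : forall m, 0 < Cmod (gauss m v)) by (intros m; now apply Cmod_gt_0, gauss_nz).
(* [growth_bound] applied to the inverses. *)
assert (H : / Cmod (gauss n v) <= / Cmod (gauss N v) * exp (2 * (32 * B ^ 2 + 4 * B))).
{ apply (growth_bound (fun n => / Cmod (gauss n v)) (2 * (32 * B ^ 2 + 4 * B)) N HN); [nra | | | exact Hn].
  - intros m. left. now apply Rinv_0_lt_compat.
  - clear n Hn; intros n Hn.
    assert (Hn' := le_INR _ _ Hn).
    assert (Hs : INR n + 1 = INR (S n)) by (rewrite S_INR; reflexivity).
    assert (HN1 : 1 <= INR N) by (apply (le_INR 1); exact HN).
    assert (H := gauss_step v B n ltac:(lia) Hp Hv ltac:(lra)).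
    assert (H1 := Cmod_triangle_lower (gauss n v) (gauss (S n) v)).
    rewrite Cmod_minus_sym in H1.
    set (K := 32 * B ^ 2 + 4 * B) in *.
    assert (HK0 : 0 <= K) by (unfold K; nra).
    set (e := K / INR (S n) ^ 2) in *.
    replace (2 * K / INR (S n) ^ 2) with (2 * e) by (unfold e; field; lra).
    (* This is where 2K <= N enters: for 0 <= e <= 1/2 one has (1 - e)(1 + 2e) >= 1, so a loss by
       the factor 1 - e costs the inverse at most 1 + 2e. *)
    assert (He : 0 <= e <= 1 / 2).
    { unfold e; split; [apply Rle_mult_inv_pos; [lra | apply pow_lt; lra]|].
      apply Rmult_le_reg_r with (INR (S n) ^ 2); [apply pow_lt; lra|].
      unfold Rdiv at 1; rewrite Rmult_assoc, Rinv_l, Rmult_1_r by (apply pow_nonzero; lra).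
      nra. }
    assert (Ha := Hpos n). assert (Hb := Hpos (S n)).
    apply Rmult_le_reg_r with (Cmod (gauss n v) * Cmod (gauss (S n) v)); [nra|].
    replace (/ Cmod (gauss (S n) v) * (Cmod (gauss n v) * Cmod (gauss (S n) v)))
      with (Cmod (gauss n v)) by (field; lra).
    replace (/ Cmod (gauss n v) * (1 + 2 * e) * (Cmod (gauss n v) * Cmod (gauss (S n) v)))
      with (Cmod (gauss (S n) v) * (1 + 2 * e)) by (field; lra).
    apply Rle_trans with ((Cmod (gauss n v) * (1 - e)) * (1 + 2 * e)).
    + assert (0 <= e * (1 - 2 * e)) by nra. nra.
    + apply Rmult_le_compat_r; lra. }
assert (HE := exp_pos (2 * (32 * B ^ 2 + 4 * B))).
assert (Ha := Hpos n). assert (Hb := Hpos N).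
apply Rmult_le_reg_r with (exp (2 * (32 * B ^ 2 + 4 * B))); [lra|].
rewrite Rmult_assoc, Rinv_l, Rmult_1_r by lra.
apply Rmult_le_reg_l with (/ Cmod (gauss n v) * / Cmod (gauss N v)).
{ apply Rmult_lt_0_compat; now apply Rinv_0_lt_compat. }
replace (/ Cmod (gauss n v) * / Cmod (gauss N v) * Cmod (gauss N v)) with (/ Cmod (gauss n v)) by (field; lra).
replace (/ Cmod (gauss n v) * / Cmod (gauss N v) * (Cmod (gauss n v) * exp (2 * (32 * B ^ 2 + 4 * B))))
  with (/ Cmod (gauss N v) * exp (2 * (32 * B ^ 2 + 4 * B))) by (field; lra).
exact H.
Qed.

Lemma exists_INR_ge (x : R) : exists N : nat, (1 <= N)%nat /\ x <= INR N.
Proof.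
destruct (nfloor_ex (Rmax x 0) (Rmax_r _ _)) as [n [_ Hn]].
exists (S n); split; [lia|]. rewrite S_INR. generalize (Rmax_l x 0); lra.
Qed.

Lemma gauss_cvg (v : C) : non_pole v -> exists l, Ccvg (fun n => gauss n v) l /\ l <> 0.
Proof.
intros Hv. set (B := Cmod v). assert (HB0 : 0 <= B) by apply Cmod_ge_0.
set (K := 32 * B ^ 2 + 4 * B). assert (HK : 0 <= K) by (unfold K; generalize (pow2_ge_0 B); lra).
destruct (exists_INR_ge (4 * B + 2 * K)) as [N [HN1 HN]].
(* A bound for all later approximants: it converts the relative increments of [gauss_step] into
   absolute ones. *)
set (G := Cmod (gauss N v) * exp K).
assert (HG : 0 <= G).
{ apply Rmult_le_pos; [apply Cmod_ge_0 | left; apply exp_pos]. }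
destruct (Ccvg_of_increments (fun n => gauss n v) (G * K) N) as [l Hl]; [exact HN1 | nra | |].
- intros n Hn. assert (Hn' := le_INR _ _ Hn).
  apply Rle_trans with (1 := gauss_step v B n ltac:(lia) Hv (Rle_refl _) ltac:(lra)).
  fold K. unfold Rdiv. rewrite <- Rmult_assoc.
  apply Rmult_le_compat_r; [left; apply Rinv_0_lt_compat, pow_lt, INR_S_pos|].
  apply Rmult_le_compat_r; [exact HK|].
  apply (gauss_upper v B N HN1 Hv (Rle_refl _)); [lra | exact Hn].
- exists l; split; [exact Hl|].
  apply Cmod_gt_0.
  apply Rlt_le_trans with (Cmod (gauss N v) * / exp (2 * K)).
  + apply Rmult_lt_0_compat; [now apply Cmod_gt_0, gauss_nz|].
    apply Rinv_0_lt_compat, exp_pos.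
  + apply Ccvg_Cmod_ge with (1 := Hl). exists N; intros n Hn.
    apply gauss_lower; auto; unfold K, B in *; lra.
Qed.

Lemma gauss_log'_cvg (v : C) : exists l, Ccvg (fun n => gauss_log' n v) l.
Proof.
destruct (exists_INR_ge (2 * Cmod v)) as [N [HN1 HN]].
apply (Ccvg_of_increments _ (2 + 2 * Cmod v) N HN1).
- generalize (Cmod_ge_0 v); lra.
- intros n Hn; assert (Hn' := le_INR _ _ Hn).
  apply gauss_log'_step; [lia | lra | lra].
Qed.

Lemma gauss_log''_cvg (v : C) : exists l, Ccvg (fun n => gauss_log'' n v) l.
Proof.
destruct (exists_INR_ge (2 * Cmod v)) as [N [HN1 HN]].
apply (Ccvg_of_increments _ 4 N HN1); [lra|].
intros n Hn; assert (Hn' := le_INR _ _ Hn).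
apply (gauss_log''_step v (Cmod v)); lra.
Qed.

(** * Locally uniform bounds and passage to the limit *)

Lemma locally_bounded (f : C -> C) (z l : C) : is_derive f z l ->
  exists r, 0 < r /\ forall v, Cmod (v - z) < r -> Cmod (f v) <= Cmod (f z) + 1.
Proof.
intros H; rewrite is_derive_C_iff in H.
destruct (H (mkposreal 1 Rlt_0_1)) as [d Hd]; simpl in Hd.
assert (Hl := Cmod_ge_0 l).
assert (Hr : 0 < Rmin d (/ (Cmod l + 1))).
{ apply Rmin_pos; [apply cond_pos | apply Rinv_0_lt_compat; lra]. }
exists (Rmin d (/ (Cmod l + 1))); split; [exact Hr|].
intros v Hv.
assert (H1 := Rlt_le_trans _ _ _ Hv (Rmin_l _ _)).
assert (H2 := Rlt_le_trans _ _ _ Hv (Rmin_r _ _)).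
specialize (Hd v H1).
replace (f v) with (f z + ((v - z) * l + (f v - f z - (v - z) * l)))%C by ring.
apply Rle_trans with (1 := Cmod_triangle _ _). apply Rplus_le_compat_l.
apply Rle_trans with (1 := Cmod_triangle _ _). rewrite Cmod_mult.
apply Rle_trans with (Cmod (v - z) * (Cmod l + 1)); [lra|].
apply Rle_trans with (/ (Cmod l + 1) * (Cmod l + 1)).
- apply Rmult_le_compat_r; lra.
- apply Req_le; field; lra.
Qed.

(** Infinitely many points must be avoided at once: for large j the size of j suffices on the whole
    unit disc around z (hence r <= 1), and the finitely many remaining j are handled by
    induction. *)
Lemma non_pole_open (z : C) : non_pole z ->
  exists r, 0 < r <= 1 /\ forall v, Cmod (v - z) < r -> non_pole v.
Proof.
intros Hz.
assert (HF : forall N : nat, exists r, 0 < r <= 1 /\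
  forall v, Cmod (v - z) < r -> forall j, (j < N)%nat -> (v + INR j)%C <> 0).
{ induction N as [|N [r [Hr IH]]].
  - exists 1; split; [lra|]. intros; lia.
  - assert (H0 : 0 < Cmod (z + INR N)) by apply Cmod_gt_0, Hz.
    assert (H1 : 0 < Rmin r (Cmod (z + INR N))) by (apply Rmin_pos; lra).
    exists (Rmin r (Cmod (z + INR N))); split; [generalize (Rmin_l r (Cmod (z + INR N))); lra|].
    intros v Hv j Hj.
    destruct (Nat.eq_dec j N) as [->|HjN].
    + intros E. apply (Rlt_irrefl (Cmod (z + INR N))).
      apply Rle_lt_trans with (Cmod (v - z)).
      * replace (v - z)%C with ((v + INR N) - (z + INR N))%C by ring.
        rewrite E. replace (0 - (z + INR N))%C with (- (z + INR N))%C by ring.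
        rewrite Cmod_opp; lra.
      * apply Rlt_le_trans with (1 := Hv), Rmin_r.
    + apply IH; [|lia]. apply Rlt_le_trans with (1 := Hv), Rmin_l. }
destruct (exists_INR_ge (2 * (Cmod z + 1))) as [N [HN1 HN]].
destruct (HF N) as [r [Hr H]].
exists r; split; [exact Hr|]. intros v Hv j.
destruct (Nat.lt_ge_cases j N) as [Hj|Hj]; [now apply H|].
apply le_INR in Hj. apply Cmod_gt_0.
apply Rlt_le_trans with (INR j / 2); [generalize (Cmod_ge_0 z); lra|].
apply Cmod_shift_ge with (Cmod z + 1); [|lra].
generalize (Cmod_triangle_lower v z); lra.
Qed.

Lemma non_pole_succ (z : C) : non_pole z -> non_pole (z + 1).
Proof.
intros H j E. apply (H (S j)). rewrite <- E, S_INR, RtoC_plus. ring.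
Qed.

(** At the fixed index N each function is bounded near z because it is differentiable there; the
    increment estimates carry the bound to every n >= N. The third logarithmic derivative is
    included because it is the second derivative of the approximants of [digamma]. *)
Lemma gauss_local_bounds (z : C) : non_pole z -> exists (r M : R) (N : nat), 0 < r /\
  (forall v, Cmod (v - z) < r -> non_pole v) /\
  forall n v, (N <= n)%nat -> Cmod (v - z) < r ->
    Cmod (gauss n v) <= M /\ Cmod (gauss_log' n v) <= M /\
    Cmod (gauss_log'' n v) <= M /\ Cmod (gauss_log''' n v) <= M.
Proof.
intros Hz.
destruct (non_pole_open z Hz) as [r0 [Hr0 Hp]].
set (B := Cmod z + 1). assert (Hz0 := Cmod_ge_0 z).
destruct (exists_INR_ge (4 * B)) as [N [HN1 HN]].
destruct (locally_bounded _ _ _ (is_derive_gauss N z Hz)) as [r1 [Hr1 H1]].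
destruct (locally_bounded _ _ _ (is_derive_gauss_log' N z Hz)) as [r2 [Hr2 H2]].
destruct (locally_bounded _ _ _ (is_derive_gauss_log'' N z Hz)) as [r3 [Hr3 H3]].
assert (H4' : exists l, is_derive (gauss_log''' N) z l).
{ unfold gauss_log'''. eexists.
  apply (is_derive_sum_n (fun j w => - (2 / ((w + INR j) * (w + INR j) * (w + INR j))))%C).
  intros j _. unfold Cdiv.
  apply (is_derive_opp (K := C_AbsRing) (V := C_NormedModule)).
  apply is_derive_Cmult; [apply is_derive_Cconst|].
  apply (is_derive_Cinv_comp (fun w => (w + INR j) * (w + INR j) * (w + INR j))%C).
  - repeat apply Cmult_neq_0; apply Hz.
  - apply is_derive_Cmult; [apply is_derive_Cmult|]; apply is_derive_shift. }
destruct H4' as [l4 H4'].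
destruct (locally_bounded _ _ _ H4') as [r4 [Hr4 H4]].
set (r := Rmin r0 (Rmin r1 (Rmin r2 (Rmin r3 r4)))).
assert (Hr : 0 < r) by (unfold r; repeat apply Rmin_pos; lra).
assert (Hle : r <= r0 /\ r <= r1 /\ r <= r2 /\ r <= r3 /\ r <= r4).
{ unfold r. generalize (Rmin_l r0 (Rmin r1 (Rmin r2 (Rmin r3 r4)))) (Rmin_r r0 (Rmin r1 (Rmin r2 (Rmin r3 r4))))
    (Rmin_l r1 (Rmin r2 (Rmin r3 r4))) (Rmin_r r1 (Rmin r2 (Rmin r3 r4)))
    (Rmin_l r2 (Rmin r3 r4)) (Rmin_r r2 (Rmin r3 r4)) (Rmin_l r3 r4) (Rmin_r r3 r4); lra. }
set (M1 := (Cmod (gauss N z) + 1) * exp (32 * B ^ 2 + 4 * B)).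
set (M2 := Cmod (gauss_log' N z) + 1 + (2 + 2 * B)).
set (M3 := Cmod (gauss_log'' N z) + 1 + 4).
set (M4 := Cmod (gauss_log''' N z) + 1 + 16).
exists r, (M1 + M2 + M3 + M4), N; split; [exact Hr|]; split.
{ intros v Hv; apply Hp; lra. }
assert (HM1 : 0 <= M1).
{ unfold M1. apply Rmult_le_pos; [generalize (Cmod_ge_0 (gauss N z)); lra | left; apply exp_pos]. }
assert (HM2 : 0 <= M2) by (unfold M2, B; generalize (Cmod_ge_0 (gauss_log' N z)); lra).
assert (HM3 : 0 <= M3) by (unfold M3; generalize (Cmod_ge_0 (gauss_log'' N z)); lra).
assert (HM4 : 0 <= M4) by (unfold M4; generalize (Cmod_ge_0 (gauss_log''' N z)); lra).
intros n v Hn Hv.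
assert (HvB : Cmod v <= B) by (unfold B; generalize (Cmod_triangle_lower v z); lra).
assert (HB : 2 <= 2 * B) by (unfold B; lra).
split; [|split; [|split]].
- apply Rle_trans with M1; [|lra].
  apply Rle_trans with (1 := gauss_upper v B N HN1 (Hp v ltac:(lra)) HvB HN n Hn).
  apply Rmult_le_compat_r; [left; apply exp_pos | apply H1; lra].
- apply Rle_trans with M2; [|lra].
  apply Rle_trans with (Cmod (gauss_log' N v) + (2 + 2 * B)).
  + apply (Cmod_le_of_increments (fun n => gauss_log' n v)); [exact HN1 | lra | | exact Hn].
    intros m Hm; assert (Hm' := le_INR _ _ Hm). apply gauss_log'_step; [lia | lra | lra].
  + apply Rplus_le_compat_r, H2; lra.
- apply Rle_trans with M3; [|lra].
  apply Rle_trans with (Cmod (gauss_log'' N v) + 4).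
  + apply (Cmod_le_of_increments (fun n => gauss_log'' n v)); [exact HN1 | lra | | exact Hn].
    intros m Hm; assert (Hm' := le_INR _ _ Hm). apply gauss_log''_step with B; lra.
  + apply Rplus_le_compat_r, H3; lra.
- apply Rle_trans with M4; [|lra].
  apply Rle_trans with (Cmod (gauss_log''' N v) + 16).
  + apply (Cmod_le_of_increments (fun n => gauss_log''' n v)); [exact HN1 | lra | | exact Hn].
    intros m Hm; assert (Hm' := le_INR _ _ Hm). apply gauss_log'''_step with B; lra.
  + apply Rplus_le_compat_r, H4; lra.
Qed.

Lemma is_derive_CGamma (z : C) : non_pole z -> exists l,
  Ccvg (fun n => gauss_log' n z) l /\ is_derive CGamma z (CGamma z * l)%C /\ CGamma z <> 0.
Proof.
intros Hz.
assert (HG : forall v, non_pole v -> Ccvg (fun n => gauss n v) (CGamma v) /\ CGamma v <> 0).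
{ intros v Hv. destruct (gauss_cvg v Hv) as [l [Hl Hl0]].
  replace (CGamma v) with l; [now split|].
  symmetry. exact (CLim_seq_unique _ _ Hl). }
destruct (gauss_log'_cvg z) as [l Hl]. exists l.
split; [exact Hl|]. split; [|now apply HG].
destruct (gauss_local_bounds z Hz) as (r & M & N & Hr & Hp & HM).
(* With L the logarithm of the approximant g, the second derivative is g L'^2 + g L'', hence the
   bound M^3 + M^2. *)
apply (derive_of_limit gauss (fun n v => gauss n v * gauss_log' n v)%C
  (fun n v => gauss n v * gauss_log' n v * gauss_log' n v + gauss n v * gauss_log'' n v)%C
  CGamma z _ r (M * M * M + M * M) N Hr).
- intros n v Hn Hv. destruct (HM n v Hn Hv) as (B1 & B2 & B3 & _).
  assert (Hnp := Hp v Hv).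
  split; [now apply is_derive_gauss|]. split.
  + apply is_derive_Cmult; [now apply is_derive_gauss | now apply is_derive_gauss_log'].
  + apply Rle_trans with (1 := Cmod_triangle _ _). rewrite !Cmod_mult.
    assert (C1 := Cmod_ge_0 (gauss n v)). assert (C2 := Cmod_ge_0 (gauss_log' n v)).
    assert (C3 := Cmod_ge_0 (gauss_log'' n v)).
    apply Rplus_le_compat; [|now apply Rmult_le_compat].
    apply Rmult_le_compat; try assumption; [nra | now apply Rmult_le_compat].
- intros v Hv. apply HG. now apply Hp.
- apply Ccvg_mult; [|exact Hl]. now apply HG.
Qed.

(** Cancels the nonzero [CGamma z]; from here on [digamma] is handled as a limit of elementary
    sums. *)
Lemma digamma_cvg (z : C) : non_pole z -> Ccvg (fun n => gauss_log' n z) (digamma z).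
Proof.
intros Hz. destruct (is_derive_CGamma z Hz) as [l [Hl [Hd H0]]].
unfold digamma. rewrite (is_C_derive_unique _ _ _ Hd).
replace (CGamma z * l / CGamma z)%C with l by (field; exact H0).
exact Hl.
Qed.

Lemma ex_derive_digamma (z : C) : non_pole z -> ex_derive digamma z.
Proof.
intros Hz. destruct (gauss_log''_cvg z) as [l Hl]. exists l.
destruct (gauss_local_bounds z Hz) as (r & M & N & Hr & Hp & HM).
apply (derive_of_limit gauss_log' gauss_log'' gauss_log''' digamma z _ r M N Hr).
- intros n v Hn Hv. assert (Hnp := Hp v Hv).
  split; [now apply is_derive_gauss_log'|]. split; [now apply is_derive_gauss_log''|].
  now apply HM.
- intros v Hv. apply digamma_cvg. now apply Hp.
- exact Hl.
Qed.

Lemma Ccvg_unique (u : nat -> C) (a b : C) : Ccvg u a -> Ccvg u b -> a = b.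
Proof. intros Ha Hb. now rewrite <- (CLim_seq_unique _ _ Ha), <- (CLim_seq_unique _ _ Hb). Qed.

Lemma gauss_log'_succ (n : nat) (z : C) : non_pole z ->
  gauss_log' n (z + 1) = (gauss_log' n z + / z - / (z + INR (S n)))%C.
Proof.
intros Hz. unfold gauss_log'.
assert (H : sum_n (fun j => / (z + 1 + INR j))%C n
            = (sum_n (fun j => / (z + INR j))%C n - / z + / (z + INR (S n)))%C).
{ induction n as [|n IH].
  - rewrite !sum_O. simpl. replace (z + 1 + 0)%C with (z + 1)%C by ring.
    replace (z + 0)%C with z by ring. ring.
  - rewrite !sum_Sn, IH. change plus with Cplus.
    replace (z + 1 + INR (S n))%C with (z + INR (S (S n)))%C.
    { match goal with |- ?a = ?b => change (@eq C a b) end. ring. }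
    rewrite (S_INR (S n)), RtoC_plus. ring. }
rewrite H. ring.
Qed.

(** No functional equation for [CGamma] is differentiated. Shifting z by 1 drops the first term of
    the finite sum and adds a last one, which tends to 0. *)
Lemma digamma_succ (z : C) : non_pole z -> digamma (z + 1) = (digamma z + / z)%C.
Proof.
intros Hz.
apply (Ccvg_unique (fun n => gauss_log' n (z + 1))).
- apply digamma_cvg. now apply non_pole_succ.
- apply (Ccvg_ext_loc (fun n => gauss_log' n z + / z - / (z + INR (S n)))%C).
  { exists O; intros n _. symmetry. now apply gauss_log'_succ. }
  replace (digamma z + / z)%C with (digamma z + / z - 0)%C by ring.
  apply Ccvg_minus; [apply Ccvg_plus; [now apply digamma_cvg | apply Ccvg_const]|].
  destruct (exists_INR_ge (2 * Cmod z)) as [N [HN1 HN]].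
  apply is_lim_seq_le_le_loc with (fun _ => 0) (fun n => 2 * / INR n).
  + exists N; intros n Hn. apply le_INR in Hn. apply (le_INR 1) in HN1. simpl INR in HN1 at 1.
    split; [apply Cmod_ge_0|].
    replace (/ (z + INR (S n)) - 0)%C with (/ (z + INR (S n)))%C by ring.
    rewrite Cmod_inv by apply Hz.
    replace (2 * / INR n) with (/ (INR n / 2)) by (field; lra).
    assert (H := Cmod_shift_ge z (Cmod z) (S n) (Rle_refl _)). rewrite S_INR in *.
    apply Rinv_le_contravar; lra.
  + apply is_lim_seq_const.
  + replace (Finite 0) with (Finite (2 * 0)) by (f_equal; ring).
    apply is_lim_seq_mult'; [apply is_lim_seq_const | apply is_lim_seq_inv_INR].
Qed.

(** * Meromorphic functions *)

Lemma locally_C_Cmod (z : C) (P : C -> Prop) :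
  locally z P <-> exists d : posreal, forall w, Cmod (w - z) < d -> P w.
Proof.
split.
- intros H; apply locally_C in H. destruct H as [d Hd].
  exists d; intros w Hw; apply Hd, Hw.
- intros [d Hd]. apply locally_C. exists d; intros w Hw; apply Hd, Hw.
Qed.

Lemma locally'_neq (z0 c : C) : locally' z0 (fun z => z <> c).
Proof.
destruct (Ceq_dec z0 c) as [->|Hc].
- apply locally_C_Cmod. exists (mkposreal 1 Rlt_0_1). auto.
- apply locally_C_Cmod.
  assert (Hd : 0 < Cmod (c - z0)) by (apply Cmod_gt_0, Cminus_eq_contra; auto).
  exists (mkposreal _ Hd); simpl; intros w Hw _ ->. lra.
Qed.

Lemma locally_locally' (z : C) (P : C -> Prop) : locally z P -> locally' z P.
Proof. intros H. apply filter_imp with (2 := H). auto. Qed.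

Lemma Cmult_Cinv_neq_0 (a : C) : a <> 0 -> (/ a)%C <> 0.
Proof.
intros Ha H. apply C1_nz. rewrite <- (Cinv_r _ Ha), H. ring.
Qed.

Lemma locally_affine (a b z0 : C) (P : C -> Prop) :
  locally (a * z0 + b)%C P -> locally z0 (fun z => P (a * z + b)%C).
Proof.
intros H. apply locally_C_Cmod in H. apply locally_C_Cmod. destruct H as [d Hd].
assert (Hd' : 0 < d / (Cmod a + 1)).
{ apply Rdiv_lt_0_compat; [apply cond_pos | generalize (Cmod_ge_0 a); lra]. }
exists (mkposreal _ Hd'); simpl; intros w Hw. apply Hd.
replace (a * w + b - (a * z0 + b))%C with (a * (w - z0))%C by ring.
rewrite Cmod_mult.
assert (Ha := Cmod_ge_0 a). assert (Hw0 := Cmod_ge_0 (w - z0)).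
apply Rle_lt_trans with ((Cmod a + 1) * Cmod (w - z0)); [nra|].
apply Rlt_le_trans with ((Cmod a + 1) * (d / (Cmod a + 1))).
- apply Rmult_lt_compat_l; lra.
- apply Req_le; field; lra.
Qed.

(** Injectivity keeps the image of a punctured neighbourhood off the image of its centre. *)
Lemma locally'_affine (a b z0 : C) (P : C -> Prop) : a <> 0 ->
  locally' (a * z0 + b)%C P -> locally' z0 (fun z => P (a * z + b)%C).
Proof.
intros Ha H. apply (locally_affine a b z0) in H.
assert (Hinj : forall x y : C, (a * x + b = a * y + b)%C -> x = y).
{ intros x y E. replace x with ((a * x + b - b) / a)%C by (field; exact Ha).
  rewrite E. field; exact Ha. }
apply filter_imp with (2 := H). intros z Hz Hne. apply Hz.
intros E. now apply Hne, Hinj.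
Qed.

(** The body of [meromorphic] at one point, so that closure properties can be proved locally and the
    global notion recovered by conversion. *)
Definition meromorphic_at (f : C -> C) (z0 : C) : Prop :=
  exists (m : nat) (g : C -> C),
    locally z0 (fun z => ex_derive g z) /\
    locally' z0 (fun z => f z = g z / (z - z0) ^ m)%C.

Lemma meromorphic_at_ext (f g : C -> C) (z0 : C) :
  locally' z0 (fun z => f z = g z) -> meromorphic_at f z0 -> meromorphic_at g z0.
Proof.
intros H (m & h & Hh & Hf). exists m, h; split; [exact Hh|].
apply filter_imp with (2 := filter_and _ _ H Hf). now intros z [<- Hz].
Qed.

Lemma meromorphic_at_holomorphic (f : C -> C) (z0 : C) :
  locally z0 (fun z => ex_derive f z) -> meromorphic_at f z0.
Proof.
intros H. exists O, f; split; [exact H|].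
apply filter_forall. intros z. simpl. field.
Qed.

Lemma ex_derive_Cmult (f g : C -> C) (z : C) :
  ex_derive f z -> ex_derive g z -> ex_derive (fun w => f w * g w)%C z.
Proof. intros [a Ha] [b Hb]. eexists. now apply is_derive_Cmult; eassumption. Qed.

Lemma ex_derive_Cplus (f g : C -> C) (z : C) :
  ex_derive f z -> ex_derive g z -> ex_derive (fun w => f w + g w)%C z.
Proof. intros [a Ha] [b Hb]. eexists. now apply is_derive_Cplus; eassumption. Qed.

Lemma ex_derive_Cpow_shift (c z : C) (n : nat) : ex_derive (fun w => (w - c) ^ n)%C z.
Proof.
induction n as [|n IH]; simpl.
- eexists; apply is_derive_Cconst.
- apply ex_derive_Cmult; [|exact IH].
  eexists; apply is_derive_Cminus; [apply is_derive_Cid | apply is_derive_Cconst].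
Qed.

Lemma meromorphic_at_const (c z0 : C) : meromorphic_at (fun _ => c) z0.
Proof.
apply meromorphic_at_holomorphic, filter_forall. intros z; eexists; apply is_derive_Cconst.
Qed.

Lemma meromorphic_at_mult (f g : C -> C) (z0 : C) :
  meromorphic_at f z0 -> meromorphic_at g z0 -> meromorphic_at (fun z => f z * g z)%C z0.
Proof.
intros (m & h & Hh & Hf) (p & k & Hk & Hg).
exists (m + p)%nat, (fun z => h z * k z)%C; split.
- apply filter_imp with (2 := filter_and _ _ Hh Hk).
  intros z [H1 H2]. now apply ex_derive_Cmult.
- apply filter_imp with (2 := filter_and _ _ (filter_and _ _ Hf Hg) (locally'_neq z0 z0)).
  intros z [[-> ->] Hz]. rewrite Cpow_add_r.
  assert (H0 : (z - z0)%C <> 0) by now apply Cminus_eq_contra.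
  field. split; now apply Cpow_nz.
Qed.

Lemma meromorphic_at_plus (f g : C -> C) (z0 : C) :
  meromorphic_at f z0 -> meromorphic_at g z0 -> meromorphic_at (fun z => f z + g z)%C z0.
Proof.
intros (m & h & Hh & Hf) (p & k & Hk & Hg).
exists (m + p)%nat, (fun z => h z * (z - z0) ^ p + k z * (z - z0) ^ m)%C; split.
- apply filter_imp with (2 := filter_and _ _ Hh Hk).
  intros z [H1 H2].
  apply ex_derive_Cplus; apply ex_derive_Cmult; auto using ex_derive_Cpow_shift.
- apply filter_imp with (2 := filter_and _ _ (filter_and _ _ Hf Hg) (locally'_neq z0 z0)).
  intros z [[-> ->] Hz]. rewrite Cpow_add_r.
  assert (H0 : (z - z0)%C <> 0) by now apply Cminus_eq_contra.
  field. split; now apply Cpow_nz.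
Qed.

Lemma meromorphic_at_minus (f g : C -> C) (z0 : C) :
  meromorphic_at f z0 -> meromorphic_at g z0 -> meromorphic_at (fun z => f z - g z)%C z0.
Proof.
intros Hf Hg.
apply meromorphic_at_ext with (fun z => f z + - (1) * g z)%C.
{ apply filter_forall; intros z; ring. }
apply meromorphic_at_plus; [exact Hf|].
apply meromorphic_at_mult; [apply meromorphic_at_const | exact Hg].
Qed.

(** The inner map is a separate [h] so that arguments such as x - n - 1 need not be written
    literally as a z + b. The factor a^m arising from (a (z - z0))^m goes into the holomorphic
    numerator. *)
Lemma meromorphic_at_affine (f h : C -> C) (a b z0 : C) : a <> 0 ->
  (forall z, h z = a * z + b)%C -> meromorphic_at f (h z0) -> meromorphic_at (fun z => f (h z)) z0.
Proof.
intros Ha Hh (m & g & Hg & Hf). rewrite Hh in Hg, Hf.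
exists m, (fun z => / a ^ m * g (a * z + b))%C; split.
- apply (locally_affine a b z0) in Hg. apply filter_imp with (2 := Hg).
  intros z [l Hl]. apply ex_derive_Cmult; [eexists; apply is_derive_Cconst|].
  eexists. apply (is_derive_Ccomp g (fun z => a * z + b)%C); [exact Hl|].
  apply is_derive_Cplus; [|apply is_derive_Cconst].
  apply is_derive_Cmult; [apply is_derive_Cconst | apply is_derive_Cid].
- apply (locally'_affine a b z0 _ Ha) in Hf.
  apply filter_imp with (2 := filter_and _ _ Hf (locally'_neq z0 z0)).
  intros z [E Hz]. rewrite Hh, E.
  replace (a * z + b - (a * z0 + b))%C with (a * (z - z0))%C by ring.
  rewrite Cpow_mult_l. field. split; apply Cpow_nz; [exact Ha | now apply Cminus_eq_contra].
Qed.

Lemma meromorphic_at_id (z0 : C) : meromorphic_at (fun z => z) z0.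
Proof.
apply meromorphic_at_holomorphic, filter_forall. intros z; eexists; apply is_derive_Cid.
Qed.

(** Only reciprocals of linear factors and their products occur in the theorem, so closure under
    general inversion, which would require factoring out zeros, is avoided. *)
Lemma meromorphic_at_inv_shift (c z0 : C) : meromorphic_at (fun z => / (z + c))%C z0.
Proof.
apply (meromorphic_at_affine (fun z => / z)%C (fun z => z + c)%C 1 c); [exact C1_nz | intros; ring |].
set (w := (z0 + c)%C). destruct (Ceq_dec w 0) as [->|Hw].
- exists 1%nat, (fun _ => RtoC 1); split.
  + apply filter_forall. intros z; eexists; apply is_derive_Cconst.
  + apply filter_imp with (2 := locally'_neq 0 0).
    assert (HE : forall z : C, z <> 0 -> (/ z = 1 / (z - 0) ^ 1)%C).
    { intros z Hz. replace (z - 0)%C with z by ring. field. exact Hz. }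
    exact HE.
- apply meromorphic_at_holomorphic. apply locally_C_Cmod.
  exists (mkposreal _ (proj1 (Cmod_gt_0 w) Hw)); simpl; intros z Hz.
  eexists; apply is_derive_Cinv. intros ->.
  replace (0 - w)%C with (- w)%C in Hz by ring. rewrite Cmod_opp in Hz. lra.
Qed.

Lemma meromorphic_at_sum_n (f : nat -> C -> C) (n : nat) (z0 : C) :
  (forall k, meromorphic_at (f k) z0) -> meromorphic_at (fun z => sum_n (fun k => f k z) n) z0.
Proof.
intros H. induction n as [|n IH].
- apply meromorphic_at_ext with (f O); [|apply H].
  apply filter_forall; intros z; now rewrite sum_O.
- apply meromorphic_at_ext with (fun z => sum_n (fun k => f k z) n + f (S n) z)%C.
  { apply filter_forall; intros z; now rewrite sum_Sn. }
  now apply meromorphic_at_plus.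
Qed.

Lemma meromorphic_at_Cprod (f : nat -> C -> C) (n : nat) (z0 : C) :
  (forall k, meromorphic_at (f k) z0) -> meromorphic_at (fun z => Cprod (fun k => f k z) n) z0.
Proof.
intros H. induction n as [|n IH]; simpl.
- apply meromorphic_at_const.
- now apply meromorphic_at_mult.
Qed.

(** * Isolated poles and meromorphy of [digamma] *)

Lemma non_pole_add_large (z : C) : exists N : nat, non_pole (z + INR N).
Proof.
destruct (exists_INR_ge (2 * Cmod z)) as [N [HN1 HN]].
exists N; intros j.
replace (z + INR N + INR j)%C with (z + INR (N + j))%C by (rewrite plus_INR, RtoC_plus; ring).
apply Cmod_gt_0.
assert (H : INR N <= INR (N + j)) by (apply le_INR; lia).
apply (le_INR 1) in HN1. simpl INR in HN1 at 1.
apply Rlt_le_trans with (INR (N + j) / 2); [lra|].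
apply Cmod_shift_ge with (Cmod z); lra.
Qed.

Lemma non_pole_locally (z : C) : non_pole z -> locally z non_pole.
Proof.
intros Hz. apply locally_C_Cmod.
destruct (non_pole_open z Hz) as [r [[Hr _] H]]. now exists (mkposreal r Hr).
Qed.

Lemma locally_shift (b z0 : C) (P : C -> Prop) :
  locally (z0 + b)%C P -> locally z0 (fun z => P (z + b)%C).
Proof.
intros H. replace (z0 + b)%C with (1 * z0 + b)%C in H by ring.
apply locally_affine in H. apply filter_imp with (2 := H).
assert (HE : forall z, (1 * z + b = z + b)%C) by (intros z; ring).
intros z. now rewrite HE.
Qed.

(** After translation by a large N no pole is near z0; the first N candidates are single points,
    each avoided by a punctured neighbourhood, even when z0 is itself a pole. *)
Lemma locally'_non_pole (z0 : C) : locally' z0 non_pole.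
Proof.
destruct (non_pole_add_large z0) as [N HN].
assert (Hopp : forall z c : C, (z + c)%C = 0 -> z = (- c)%C).
{ intros z c E. replace z with (z + c - c)%C by ring. rewrite E. ring. }
assert (Hge : forall (z : C) j, (N <= j)%nat -> (z + INR N + INR (j - N))%C = (z + INR j)%C).
{ intros z j Hj. rewrite minus_INR, RtoC_minus by exact Hj. ring. }
assert (H : forall n, locally' z0 (fun z => forall j, (j < n)%nat -> (z + INR j)%C <> 0)).
{ induction n as [|n IH].
  - apply filter_forall; intros z j Hj; lia.
  - apply filter_imp with (2 := filter_and _ _ IH (locally'_neq z0 (- INR n)%C)).
    intros z [H1 H2] j Hj. destruct (Nat.eq_dec j n) as [->|Hn]; [|apply H1; lia].
    intros E. apply H2. now apply Hopp. }
apply filter_imp with (2 := filter_and _ _ (H N)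
  (locally_locally' _ _ (locally_shift _ _ _ (non_pole_locally _ HN)))).
intros z [H1 H2] j. destruct (Nat.lt_ge_cases j N) as [Hj|Hj]; [now apply H1|].
rewrite <- Hge by exact Hj. apply H2.
Qed.

Lemma non_pole_add (z : C) (n : nat) : non_pole z -> non_pole (z + INR n).
Proof.
intros H j. replace (z + INR n + INR j)%C with (z + INR (n + j))%C by (rewrite plus_INR, RtoC_plus; ring).
apply H.
Qed.

(** Near any point, poles included, this writes [digamma] as a translate that is holomorphic once n
    is large, minus finitely many simple fractions. *)
Lemma digamma_add (z : C) (n : nat) : non_pole z ->
  digamma z = (digamma (z + INR (S n)) - sum_n (fun j => / (z + INR j)) n)%C.
Proof.
intros Hz.
assert (Hs : forall m, digamma (z + INR (S m)) = (digamma (z + INR m) + / (z + INR m))%C).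
{ intros m. rewrite S_INR, RtoC_plus, Cplus_assoc. apply digamma_succ. now apply non_pole_add. }
induction n as [|n IH].
- rewrite sum_O, Hs. simpl INR. replace (z + 0)%C with z by ring. ring.
- rewrite sum_Sn, Hs, IH at 1. change plus with Cplus. ring.
Qed.

Lemma meromorphic_at_digamma (z0 : C) : meromorphic_at digamma z0.
Proof.
destruct (non_pole_add_large z0) as [N HN].
assert (HN1 : non_pole (z0 + INR (S N))).
{ rewrite S_INR, RtoC_plus, Cplus_assoc. now apply non_pole_succ. }
apply meromorphic_at_ext with (fun z => digamma (z + INR (S N)) - sum_n (fun j => / (z + INR j)) N)%C.
- apply filter_imp with (2 := locally'_non_pole z0). intros z Hz. symmetry. now apply digamma_add.
- apply meromorphic_at_minus.
  + apply (meromorphic_at_affine digamma (fun z => z + INR (S N))%C 1 (INR (S N)));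
      [exact C1_nz | intros; ring |].
    apply meromorphic_at_holomorphic.
    apply filter_imp with (2 := non_pole_locally _ HN1).
    intros z Hz. now apply ex_derive_digamma.
  + apply meromorphic_at_sum_n. intros k. apply meromorphic_at_inv_shift.
Qed.

Lemma meromorphic_at_Harm (h : C -> C) (a b z0 : C) : a <> 0 ->
  (forall z, h z = a * z + b)%C -> meromorphic_at (fun z => Harm (h z)) z0.
Proof.
intros Ha Hh. unfold Harm.
apply meromorphic_at_plus; [|apply meromorphic_at_const].
apply (meromorphic_at_affine digamma (fun z => h z + 1)%C a (b + 1)%C).
- exact Ha.
- intros z. rewrite Hh. ring.
- apply meromorphic_at_digamma.
Qed.

(** * Binomial coefficients and their reciprocals as meromorphic functions *)

Lemma Cinv_0 : (/ 0)%C = 0.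
Proof. unfold Cinv, RtoC; simpl. f_equal; unfold Rdiv; ring. Qed.

(** The convention 1/0 = 0 makes inversion multiplicative everywhere, so the reciprocal of a
    binomial coefficient splits into linear factors even at its zeros. *)
Lemma Cinv_mult_total (a b : C) : (/ (a * b) = / a * / b)%C.
Proof.
destruct (Ceq_dec a 0) as [->|Ha]; [rewrite Cmult_0_l, Cinv_0; ring|].
destruct (Ceq_dec b 0) as [->|Hb]; [rewrite Cmult_0_r, Cinv_0; ring|].
field; auto.
Qed.

Lemma Cinv_Cprod (f : nat -> C) (n : nat) : (/ Cprod f n = Cprod (fun j => / f j) n)%C.
Proof.
induction n as [|n IH]; simpl.
- field.
- now rewrite Cinv_mult_total, IH.
Qed.

Lemma meromorphic_at_Cbinom (h : C -> C) (k : nat) (z0 : C) :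
  meromorphic_at h z0 -> meromorphic_at (fun z => Cbinom (h z) k) z0.
Proof.
intros H. unfold Cbinom, Cdiv.
apply meromorphic_at_mult; [|apply meromorphic_at_const].
apply (meromorphic_at_Cprod (fun j z => h z - INR j)%C). intros j.
apply meromorphic_at_minus; [exact H | apply meromorphic_at_const].
Qed.

Lemma meromorphic_at_inv_Cbinom (k : nat) (z0 : C) :
  meromorphic_at (fun z => / Cbinom z k)%C z0.
Proof.
apply meromorphic_at_ext with (fun z => Cprod (fun j => / (z + - INR j)) k * / / INR (fact k))%C.
- apply filter_forall; intros z. unfold Cbinom, Cdiv.
  now rewrite Cinv_mult_total, Cinv_Cprod.
- apply meromorphic_at_mult; [|apply meromorphic_at_const].
  apply (meromorphic_at_Cprod (fun j z => / (z + - INR j))%C). intros j.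
  apply meromorphic_at_inv_shift.
Qed.

(** * The binomial identity *)

Local Open Scope C_scope.

(* [ring] and [field] do not recognise C behind the carrier projection of a
   Coquelicot structure. *)
Ltac in_C := match goal with |- @eq _ ?a ?b => change (@eq C a b) end.

Lemma INR_S_C_nz (n : nat) : RtoC (INR (S n)) <> 0.
Proof. intros H; apply RtoC_inj in H. exact (not_0_INR (S n) (Nat.neq_succ_0 n) H). Qed.

Lemma INR_fact_C_nz (n : nat) : RtoC (INR (fact n)) <> 0.
Proof. intros H; apply RtoC_inj in H. exact (INR_fact_neq_0 n H). Qed.

Lemma RtoC_2_nz : RtoC 2 <> 0.
Proof. intros H; apply RtoC_inj in H. lra. Qed.

Lemma Csum_S (f : nat -> C) (n : nat) : sum_n f (S n) = sum_n f n + f (S n).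
Proof. now rewrite sum_Sn. Qed.

Lemma Csum_S_l (f : nat -> C) (n : nat) : sum_n f (S n) = f O + sum_n (fun k => f (S k)) n.
Proof.
induction n as [|n IH].
- now rewrite Csum_S, !sum_O.
- rewrite Csum_S, IH, (Csum_S (fun k => f (S k))). in_C. ring.
Qed.

Lemma Csum_mult_l (c : C) (f : nat -> C) (n : nat) : sum_n (fun k => c * f k) n = c * sum_n f n.
Proof.
induction n as [|n IH].
- now rewrite !sum_O.
- rewrite !Csum_S, IH. in_C. ring.
Qed.

Lemma Csum_plus (f g : nat -> C) (n : nat) : sum_n (fun k => f k + g k) n = sum_n f n + sum_n g n.
Proof.
induction n as [|n IH].
- now rewrite !sum_O.
- rewrite !Csum_S, IH. in_C. ring.
Qed.

Lemma Cbinom_0 (x : C) : Cbinom x 0 = 1.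
Proof. unfold Cbinom; simpl. field. Qed.

Lemma Cbinom_S (x : C) (k : nat) : INR (S k) * Cbinom x (S k) = (x - INR k) * Cbinom x k.
Proof.
unfold Cbinom. replace (fact (S k)) with (S k * fact k)%nat by reflexivity.
rewrite mult_INR, RtoC_mult. simpl Cprod. field.
split; [apply INR_fact_C_nz | apply INR_S_C_nz].
Qed.

Lemma Cbinom_vandermonde (x y : C) (n : nat) :
  Cbinom (x + y) n = sum_n (fun k => Cbinom x (n - k) * Cbinom y k) n.
Proof.
induction n as [|n IH].
{ rewrite sum_O. simpl. rewrite !Cbinom_0. ring. }
assert (Hn := INR_S_C_nz n).
assert (E : INR (S n) * Cbinom (x + y) (S n)
            = INR (S n) * sum_n (fun k => Cbinom x (S n - k) * Cbinom y k) (S n)).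
{ rewrite Cbinom_S, IH, <- !Csum_mult_l.
  (* Split x + y - n as (x - (n - k)) + (y - k) and let each part raise the lower index of its own
     binomial by [Cbinom_S]. *)
  transitivity (sum_n (fun k => INR (S n - k) * Cbinom x (S n - k) * Cbinom y k
                              + Cbinom x (n - k) * (INR (S k) * Cbinom y (S k))) n).
  - apply sum_n_ext_loc. intros k Hk.
    replace (S n - k)%nat with (S (n - k)) by lia.
    rewrite !Cbinom_S, minus_INR, RtoC_minus by exact Hk.
    in_C. ring.
  - rewrite Csum_plus.
    (* Both sums extend to 0..n+1 because the added terms carry the factor 0; the weights n+1-k and
       k then add up to n+1. *)
    transitivity (sum_n (fun k => INR (S n - k) * Cbinom x (S n - k) * Cbinom y k) (S n)
                + sum_n (fun k => Cbinom x (S n - k) * (INR k * Cbinom y k)) (S n)).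
    + rewrite (Csum_S (fun k => INR (S n - k) * Cbinom x (S n - k) * Cbinom y k)).
      rewrite (Csum_S_l (fun k => Cbinom x (S n - k) * (INR k * Cbinom y k))).
      rewrite Nat.sub_diag. simpl (INR 0).
      change (fun k => Cbinom x (S n - S k) * (INR (S k) * Cbinom y (S k)))
        with (fun k => Cbinom x (n - k) * (INR (S k) * Cbinom y (S k))).
      in_C. ring.
    + rewrite <- Csum_plus. apply sum_n_ext_loc. intros k Hk.
      rewrite minus_INR, RtoC_minus by exact Hk.
      in_C. ring. }
transitivity (INR (S n) * Cbinom (x + y) (S n) / INR (S n)); [field; exact Hn|].
rewrite E. field; exact Hn.
Qed.

Lemma catalan_S (k : nat) :
  ((INR k + 2) * catalan (S k) = 2 * (2 * INR k + 1) * catalan k)%R.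
Proof.
unfold catalan, Binomial.C.
replace (2 * S k - S k)%nat with (S k) by lia. replace (2 * k - k)%nat with k by lia.
replace (2 * S k)%nat with (S (S (2 * k))) by lia.
rewrite !fact_simpl, !mult_INR, !S_INR, !mult_INR. simpl (INR 2).
assert (Hf := INR_fact_neq_0 k). assert (H0 := pos_INR k).
simpl; field. repeat split; lra.
Qed.

(** Coefficient form of the Catalan generating function: sum_k C_k (-t/4)^k = 2 (sqrt(1 + t) - 1)/t.
    The proof compares the first-order recurrences of both sides. *)
Lemma Cbinom_half (k : nat) :
  2 * Cbinom (1 / 2) (S k) = (-1) ^ k / 2 ^ (2 * k) * catalan k.
Proof.
induction k as [|k IH].
- unfold Cbinom, catalan, Binomial.C. simpl. apply injective_projections; simpl; field.
- assert (H2 := INR_S_C_nz (S k)).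
  transitivity (INR (S (S k)) * Cbinom (1 / 2) (S (S k)) * 2 / INR (S (S k))); [field; exact H2|].
  rewrite Cbinom_S.
  replace ((1 / 2 - INR (S k)) * Cbinom (1 / 2) (S k) * 2 / INR (S (S k)))
    with ((1 / 2 - INR (S k)) * (2 * Cbinom (1 / 2) (S k)) / INR (S (S k))) by (field; exact H2).
  rewrite IH.
  assert (HC := f_equal RtoC (catalan_S k)).
  rewrite !RtoC_mult, !RtoC_plus, RtoC_mult in HC.
  replace (2 * S k)%nat with (S (S (2 * k))) by lia. rewrite !Cpow_S.
  assert (HP : RtoC 2 ^ (2 * k) <> 0) by apply Cpow_nz, RtoC_2_nz.
  assert (E : RtoC (INR (S (S k))) = INR k + 2).
  { rewrite !S_INR, !RtoC_plus. ring. }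
  rewrite E in *.
  replace (RtoC (catalan (S k))) with (2 * (2 * INR k + 1) * catalan k / (INR k + 2))
    by (rewrite <- HC; field; exact H2).
  rewrite S_INR, RtoC_plus.
  clear IH. generalize dependent (RtoC 2 ^ (2 * k)). intros p HP.
  generalize ((-1) ^ k). intros q.
  field. repeat split; auto using RtoC_2_nz.
Qed.

(** In Vandermonde's sum of order n+1, the term k = 0 is [Cbinom x (S n)], which is subtracted on
    the right; the other terms shift down by one index. *)
Lemma sum_catalan_Cbinom (x : C) (n : nat) :
  sum_n (fun k => (-1) ^ k / 2 ^ (2 * k) * catalan k * Cbinom x (n - k)) n
  = 2 * Cbinom (x + 1 / 2) (S n) - 2 * Cbinom x (S n).
Proof.
rewrite Cbinom_vandermonde, Csum_S_l, Cbinom_0, Nat.sub_0_r.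
transitivity (2 * sum_n (fun k => Cbinom x (S n - S k) * Cbinom (1 / 2) (S k)) n); [|in_C; ring].
rewrite <- Csum_mult_l. apply sum_n_ext. intros k.
rewrite <- Cbinom_half. simpl (S n - S k)%nat.
in_C. ring.
Qed.

(** Sorting by parity: j = 2i gives 2 (x + 1/2 - i) and j = 2i + 1 gives 2 (x - i). *)
Lemma Cprod_double (x : C) (m : nat) :
  Cprod (fun j => 2 * x + 1 - INR j) (2 * m)
  = 2 ^ (2 * m) * Cprod (fun j => x + 1 / 2 - INR j) m * Cprod (fun j => x - INR j) m.
Proof.
induction m as [|m IH].
- simpl. ring.
- replace (2 * S m)%nat with (S (S (2 * m))) by lia.
  rewrite !Cpow_S.
  change (Cprod (fun j => 2 * x + 1 - INR j) (S (S (2 * m))))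
    with (Cprod (fun j => 2 * x + 1 - INR j) (2 * m) * (2 * x + 1 - INR (2 * m)) * (2 * x + 1 - INR (S (2 * m)))).
  change (Cprod (fun j => x + 1 / 2 - INR j) (S m))
    with (Cprod (fun j => x + 1 / 2 - INR j) m * (x + 1 / 2 - INR m)).
  change (Cprod (fun j => x - INR j) (S m)) with (Cprod (fun j => x - INR j) m * (x - INR m)).
  rewrite IH, S_INR, mult_INR, RtoC_plus, RtoC_mult. simpl (INR 2).
  generalize (Cprod (fun j => x + 1 / 2 - INR j) m) (Cprod (fun j => x - INR j) m) (RtoC 2 ^ (2 * m)).
  intros a b c. rewrite RtoC_plus. field.
Qed.

(** After [Cprod_double] the product over x - j cancels against the denominator, and the powers of 2
    and factorials collapse to 2/(n+1)!. *)
Lemma Cbinom_double (x : C) (n : nat) : Cbinom x (n + 1) <> 0 ->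
  (2 * INR n + 1) / 2 ^ (2 * n) * (Cbinom (2 * x + 1) (2 * n + 2) / Cbinom x (n + 1)) * catalan n
  = 2 * Cbinom (x + 1 / 2) (S n).
Proof.
rewrite Nat.add_1_r. intros H.
unfold catalan, Binomial.C. unfold Cbinom in *.
replace (2 * n + 2)%nat with (2 * S n)%nat by lia.
replace (2 * n - n)%nat with n by lia.
assert (Hp : Cprod (fun j => x - INR j) (S n) <> 0).
{ intros E; apply H. rewrite E. unfold Cdiv. ring. }
rewrite Cprod_double.
generalize dependent (Cprod (fun j => x - INR j) (S n)). intros p _ Hp.
generalize (Cprod (fun j => x + 1 / 2 - INR j) (S n)). intros q.
replace (2 * S n)%nat with (S (S (2 * n))) by lia.
rewrite !Cpow_S, !fact_simpl, !mult_INR.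
assert (Hn0 := not_0_INR (S n) (Nat.neq_succ_0 n)). rewrite S_INR in Hn0.
rewrite !RtoC_mult, RtoC_inv, RtoC_div, !RtoC_mult, ?S_INR, ?mult_INR, ?RtoC_plus, ?RtoC_mult, ?RtoC_plus, ?RtoC_mult.
2: { apply Rmult_integral_contrapositive_currified; apply INR_fact_neq_0. }
2: { exact Hn0. }
assert (HP : RtoC 2 ^ (2 * n) <> 0) by apply Cpow_nz, RtoC_2_nz.
assert (F1 := INR_fact_C_nz n). assert (F2 := INR_fact_C_nz (2 * n)).
assert (HS : INR n + 1 <> 0) by (rewrite <- RtoC_plus, <- S_INR; apply INR_S_C_nz).
assert (HS1 : 2 * INR n + 1 <> 0).
{ rewrite <- RtoC_mult, <- RtoC_plus. change 2%R with (INR 2).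
  rewrite <- mult_INR, <- S_INR. apply INR_S_C_nz. }
assert (HS2 : 2 * INR n + 1 + 1 <> 0).
{ rewrite <- RtoC_mult, <- !RtoC_plus. change 2%R with (INR 2).
  rewrite <- mult_INR, <- !S_INR. apply INR_S_C_nz. }
generalize dependent (RtoC 2 ^ (2 * n)). intros r Hr.
simpl (INR 2) in *. rewrite ?RtoC_plus in *.
field.
repeat split; auto.
Qed.

(** Both the logarithmic derivative of [Cbinom x k] and the difference of harmonic numbers at x and
    x - k. A recursion of its own provides the empty sum at k = 0, whereas [sum_n] always contains
    index 0. *)
Fixpoint reciprocal_sum (x : C) (k : nat) : C :=
  match k with
  | O => 0
  | S m => reciprocal_sum x m + / (x - INR m)
  end.

Lemma is_derive_Cbinom (c x : C) (k : nat) :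
  (forall j, (j < k)%nat -> x + c - INR j <> 0) ->
  is_derive (fun y => Cbinom (y + c) k) x (Cbinom (x + c) k * reciprocal_sum (x + c) k).
Proof.
intros H.
assert (HP : is_derive (fun y => Cprod (fun j => y + c - INR j) k) x
               (Cprod (fun j => x + c - INR j) k * reciprocal_sum (x + c) k)).
{ induction k as [|k IH]; simpl.
  - eapply is_derive_eq; [apply is_derive_Cconst | ring].
  - eapply is_derive_eq.
    + apply is_derive_Cmult; [apply IH; intros; apply H; lia|].
      apply is_derive_Cminus; [apply is_derive_shift | apply is_derive_Cconst].
    + cbv beta. field. apply H. lia. }
unfold Cbinom, Cdiv. eapply is_derive_eq.
- apply is_derive_Cmult; [exact HP | apply is_derive_Cconst].
- cbv beta. ring.
Qed.

(** The logarithmic derivative of [Cprod_double], obtained by the same pairing of even and odd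
    indices. *)
Lemma reciprocal_sum_double (x : C) (m : nat) :
  2 * reciprocal_sum (2 * x + 1) (2 * m) = reciprocal_sum (x + 1 / 2) m + reciprocal_sum x m.
Proof.
induction m as [|m IH].
- simpl. ring.
- replace (2 * S m)%nat with (S (S (2 * m))) by lia. simpl reciprocal_sum.
  replace (m + (m + 0))%nat with (2 * m)%nat by lia.
  assert (E0 : RtoC (INR (2 * m)) = 2 * INR m) by now rewrite mult_INR, RtoC_mult.
  assert (E1 : 2 * x + 1 - INR (2 * m) = 2 * (x + 1 / 2 - INR m)) by (rewrite E0; field).
  assert (E2 : 2 * x + 1 - INR (S (2 * m)) = 2 * (x - INR m))
    by (rewrite S_INR, RtoC_plus, E0; ring).
  change (match (2 * m)%nat with O => 1%R | S _ => (INR (2 * m) + 1)%R end) with (INR (S (2 * m))).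
  rewrite E1, E2, !Cinv_mult_total.
  transitivity (2 * reciprocal_sum (2 * x + 1) (2 * m) + / (x + 1 / 2 - INR m) + / (x - INR m)).
  + generalize (/ (x + 1 / 2 - INR m)) (/ (x - INR m)); intros u v. field.
  + rewrite IH. ring.
Qed.

(** [Harm] evaluates [digamma] one step to the right, hence the + 1 in the condition. It is imposed
    at the lowest argument only, since [non_pole] passes upwards. *)
Lemma Harm_sub (y : C) (k : nat) :
  non_pole (y - INR k + 1) -> Harm (y - INR k) = Harm y - reciprocal_sum y k.
Proof.
induction k as [|k IH]; intros H.
- simpl. replace (y - 0) with y by ring. ring.
- assert (E : y - INR (S k) + 1 = y - INR k) by (rewrite S_INR, RtoC_plus; ring).
  rewrite E in H. simpl reciprocal_sum.
  assert (E2 := IH (non_pole_succ _ H)). unfold Harm in *.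
  rewrite E. rewrite (digamma_succ _ H) in E2.
  replace (digamma (y - INR k)) with
    (digamma (y - INR k) + / (y - INR k) + euler_mascheroni - / (y - INR k) - euler_mascheroni) by ring.
  rewrite E2. ring.
Qed.

(** Differentiates [sum_catalan_Cbinom]: both sides are the derivative at x of the same function.
    The nonvanishing conditions allow derivatives of binomials to be written with
    [reciprocal_sum]. *)
Lemma sum_catalan_Cbinom_deriv (x : C) (n : nat) :
  (forall j, (j <= n)%nat -> x - INR j <> 0) ->
  (forall j, (j <= n)%nat -> x + 1 / 2 - INR j <> 0) ->
  sum_n (fun k => (-1) ^ k / 2 ^ (2 * k) * catalan k
                  * (Cbinom x (n - k) * reciprocal_sum x (n - k))) n
  = 2 * (Cbinom (x + 1 / 2) (S n) * reciprocal_sum (x + 1 / 2) (S n))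
    - 2 * (Cbinom x (S n) * reciprocal_sum x (S n)).
Proof.
intros H1 H2.
assert (H0 : forall k, (k <= S n)%nat ->
          is_derive (fun y => Cbinom y k) x (Cbinom x k * reciprocal_sum x k)).
{ intros k Hk.
  apply is_derive_ext with (fun y => Cbinom (y + 0) k).
  { intros t. f_equal. apply Cplus_0_r. }
  replace (Cbinom x k * reciprocal_sum x k) with (Cbinom (x + 0) k * reciprocal_sum (x + 0) k)
    by now rewrite Cplus_0_r.
  apply is_derive_Cbinom. intros j Hj. rewrite Cplus_0_r. apply H1. lia. }
pose (S1 := fun y => sum_n (fun k => (-1) ^ k / 2 ^ (2 * k) * catalan k * Cbinom y (n - k)) n).
transitivity (C_derive S1 x).
- symmetry. apply is_C_derive_unique.
  apply (is_derive_sum_n (fun k y => (-1) ^ k / 2 ^ (2 * k) * catalan k * Cbinom y (n - k))).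
  intros k Hk. eapply is_derive_eq.
  + apply is_derive_Cmult; [apply is_derive_Cconst | apply H0; lia].
  + cbv beta. ring.
- apply is_C_derive_unique.
  apply is_derive_ext with (fun y => 2 * Cbinom (y + 1 / 2) (S n) - 2 * Cbinom y (S n)).
  { intros y. symmetry. apply sum_catalan_Cbinom. }
  eapply is_derive_eq.
  + apply is_derive_Cminus; (apply is_derive_Cmult; [apply is_derive_Cconst|]).
    * apply is_derive_Cbinom. intros j Hj. apply H2. lia.
    * apply H0. lia.
  + cbv beta. ring.
Qed.

Lemma Cbinom_nz (x : C) (k : nat) : (forall j, (j < k)%nat -> x - INR j <> 0) -> Cbinom x k <> 0.
Proof.
intros H. unfold Cbinom, Cdiv. apply Cmult_neq_0.
- now apply Cprod_nz.
- apply Cmult_Cinv_neq_0, INR_fact_C_nz.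
Qed.

Lemma sum_catalan_Cbinom_Harm (n : nat) (x : C) : non_pole (2 * x - 2 * INR n) ->
  sum_n (fun k : nat =>
      (-1) ^ k / 2 ^ (2 * k) * Cbinom x (n - k) * catalan k
      * Harm (x + INR k - INR n)) n
  = (2 * INR n + 1) / 2 ^ (2 * n)
    * (Cbinom (2 * x + 1) (2 * n + 2) / Cbinom x (n + 1))
    * (2 * Harm x - Harm (x - INR n - 1)
       + 2 * Harm (2 * x - 2 * INR n - 1) - 2 * Harm (2 * x + 1))
    * catalan n
    - 2 * Cbinom x (n + 1) * Harm (x - INR n - 1).
Proof.
intros H.
(* The even offsets in [H] yield this condition; the odd ones yield [H2] below. *)
assert (Hxn : non_pole (x - INR n)).
{ intros j E. apply (H (2 * j)%nat).
  transitivity (2 * (x - INR n + INR j)); [|rewrite E; ring].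
  rewrite mult_INR, RtoC_mult. change (INR 2) with 2%R. ring. }
assert (H1 : forall j, (j <= n)%nat -> x - INR j <> 0).
{ intros j Hj E. apply (Hxn (n - j)%nat). rewrite minus_INR, RtoC_minus by exact Hj.
  rewrite <- E. ring. }
assert (H2 : forall j, (j <= n)%nat -> x + 1 / 2 - INR j <> 0).
{ intros j Hj E. apply (H (S (2 * (n - j)))%nat).
  transitivity (2 * (x + 1 / 2 - INR j)); [|rewrite E; ring].
  rewrite S_INR, mult_INR, minus_INR, RtoC_plus, RtoC_mult, RtoC_minus by exact Hj.
  change (INR 2) with 2%R. field. }
assert (HB : Cbinom x (n + 1) <> 0).
{ apply Cbinom_nz. intros j Hj. apply H1. lia. }
assert (En : x - INR n - 1 = x - INR (S n)) by (rewrite S_INR, RtoC_plus; ring).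
assert (E2n : 2 * x - 2 * INR n - 1 = 2 * x + 1 - INR (2 * S n)).
{ rewrite mult_INR. change (INR 2) with 2%R. rewrite S_INR, RtoC_mult, RtoC_plus. ring. }
rewrite En, E2n.
rewrite (Harm_sub x (S n)).
2:{ now replace (x - INR (S n) + 1) with (x - INR n) by (rewrite S_INR, RtoC_plus; ring). }
rewrite (Harm_sub (2 * x + 1) (2 * S n)).
2:{ rewrite <- E2n. now replace (2 * x - 2 * INR n - 1 + 1) with (2 * x - 2 * INR n) by ring. }
set (A := Cbinom (x + 1 / 2) (S n)).
set (T := reciprocal_sum x (S n)).
set (T' := reciprocal_sum (x + 1 / 2) (S n)).
(* The common value S(x) H_x - S'(x), with S and S' taken from the closed form of the sum. *)
transitivity (2 * A * (Harm x - T') - 2 * Cbinom x (S n) * (Harm x - T)).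
- transitivity
    (Harm x * sum_n (fun k => (-1) ^ k / 2 ^ (2 * k) * catalan k * Cbinom x (n - k)) n
     + - (1) * sum_n (fun k => (-1) ^ k / 2 ^ (2 * k) * catalan k
                  * (Cbinom x (n - k) * reciprocal_sum x (n - k))) n).
  + rewrite <- !Csum_mult_l, <- Csum_plus. apply sum_n_ext_loc. intros k Hk.
    replace (x + INR k - INR n) with (x - INR (n - k))
      by (rewrite minus_INR, RtoC_minus by exact Hk; ring).
    rewrite Harm_sub.
    2:{ replace (x - INR (n - k) + 1) with (x - INR n + INR (S k)).
        - now apply non_pole_add.
        - rewrite minus_INR, S_INR, RtoC_minus, RtoC_plus by exact Hk. ring. }
    in_C. ring.
  + rewrite sum_catalan_Cbinom, (sum_catalan_Cbinom_deriv x n H1 H2).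
    fold A T T'. in_C. ring.
- assert (HA := Cbinom_double x n HB). fold A in HA. rewrite <- HA.
  assert (HT := reciprocal_sum_double x (S n)). fold T T' in HT.
  replace T' with (2 * reciprocal_sum (2 * x + 1) (2 * S n) - T) by (rewrite HT; ring).
  rewrite Nat.add_1_r. in_C. ring.
Qed.

Theorem theorem10 (n : nat) :
  let lhs := fun x : C =>
    sum_n (fun k : nat =>
      (-1) ^ k / 2 ^ (2 * k) * Cbinom x (n - k) * catalan k
      * Harm (x + INR k - INR n)) n in
  let rhs := fun x : C =>
    (2 * INR n + 1) / 2 ^ (2 * n)
    * (Cbinom (2 * x + 1) (2 * n + 2) / Cbinom x (n + 1))
    * (2 * Harm x - Harm (x - INR n - 1)
       + 2 * Harm (2 * x - 2 * INR n - 1) - 2 * Harm (2 * x + 1))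
    * catalan n
    - 2 * Cbinom x (n + 1) * Harm (x - INR n - 1) in
  meromorphic_eq lhs rhs /\
  (forall x : C,
     (forall m : Z, (m <= 2 * Z.of_nat n)%Z -> 2 * x <> IZR m) ->
     lhs x = rhs x).
Proof.
intros lhs rhs. split; [split; [|split]|].
- intros z0. change (meromorphic_at lhs z0). unfold lhs.
  apply (meromorphic_at_sum_n (fun k x => (-1) ^ k / 2 ^ (2 * k) * Cbinom x (n - k) * catalan k
      * Harm (x + INR k - INR n))). intros k.
  apply meromorphic_at_mult.
  + apply meromorphic_at_mult; [|apply meromorphic_at_const].
    apply meromorphic_at_mult; [apply meromorphic_at_const|].
    apply (meromorphic_at_Cbinom (fun x => x)), meromorphic_at_id.
  + apply (meromorphic_at_Harm _ 1 (INR k - INR n)); [exact C1_nz | intros; ring].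
- intros z0. change (meromorphic_at rhs z0). unfold rhs.
  assert (HH : meromorphic_at (fun x => Harm (x - INR n - 1)) z0).
  { apply (meromorphic_at_Harm _ 1 (- INR n - 1)); [exact C1_nz | intros; ring]. }
  assert (HL : meromorphic_at (fun x => 2 * x + 1) z0).
  { apply meromorphic_at_plus; [|apply meromorphic_at_const].
    apply meromorphic_at_mult; [apply meromorphic_at_const | apply meromorphic_at_id]. }
  apply meromorphic_at_minus; (apply meromorphic_at_mult; [|try exact HH]).
  + apply meromorphic_at_mult; [apply meromorphic_at_mult; [apply meromorphic_at_const|]|].
    * unfold Cdiv. apply meromorphic_at_mult; [|apply meromorphic_at_inv_Cbinom].
      now apply (meromorphic_at_Cbinom (fun x => 2 * x + 1)).
    * apply meromorphic_at_minus; [apply meromorphic_at_plus; [apply meromorphic_at_minus; [|exact HH]|]|];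
        (apply meromorphic_at_mult; [apply meromorphic_at_const|]).
      { apply (meromorphic_at_Harm _ 1 0); [exact C1_nz | intros; ring]. }
      { apply (meromorphic_at_Harm _ 2 (- (2 * INR n) - 1)); [exact RtoC_2_nz | intros; ring]. }
      { apply (meromorphic_at_Harm _ 2 1); [exact RtoC_2_nz | intros; ring]. }
  + apply meromorphic_at_const.
  + apply meromorphic_at_mult; [apply meromorphic_at_const|].
    apply (meromorphic_at_Cbinom (fun x => x)), meromorphic_at_id.
- intros z0.
  (* The exceptional points are preimages of the poles under z -> 2z - 2n, hence isolated, and the
     pointwise identity holds off them. *)
  apply filter_imp with (2 := locally'_affine 2 (- (2 * INR n)) z0 non_pole RtoC_2_nz
                                (locally'_non_pole _)).
  intros x Hx. exact (sum_catalan_Cbinom_Harm n x Hx).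
- intros x Hx. refine (sum_catalan_Cbinom_Harm n x _). intros j E.
  (* A vanishing 2x - 2n + j would make 2x the integer 2n - j <= 2n, which is excluded. *)
  apply (Hx (2 * Z.of_nat n - Z.of_nat j)%Z); [lia|].
  rewrite minus_IZR, mult_IZR, <- !INR_IZR_INZ, RtoC_minus, RtoC_mult.
  replace (2 * x) with (2 * x - 2 * INR n + INR j + (2 * INR n - INR j)) by ring.
  rewrite E. ring.
Qed.
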